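(* Let $\sigma$ be a tall Schröder path of size $n$. Then \[ \mathbf{p}_{\mathbbm{1}}\Big(\operatorname{Ind}^{\mathrm{GL}_n}_{\mathrm{UT}_n}(\psi^\sigma)\Big)=(q-1)^{|\operatorname{Diag}(\sigma)|}\,\omega\, G_\sigma(\mathbf{x};q). \]
   Context: $q$ prime power, $\mathrm{GL}_n=\mathrm{GL}_n(\mathbb{F}_q)$, $\mathrm{UT}_n$ unipotent upper triangular subgroup, $B_n$ upper triangular subgroup. Schröder path of size $n$: lattice path from $(0,0)$ to $(n,-n)$ with steps $E=(1,0)$, $S=(0,-1)$, $D=(1,-1)$ never going below the line $y=-x$; it is tall if it has no $D$ step from a point $(k,-k)$ to $(k+1,-k-1)$ on the main diagonal. For $1\le i<j\le n$ let the unit square $\{i,j\}$ be $[j-1,j]\times[-i,-i+1]$. $\operatorname{Area}(\sigma)$ = set of $\{i,j\}$ whose square lies completely below $\sigma$ (between $\sigma$ and the diagonal); $\operatorname{Diag}(\sigma)$ = set of $\{i,j\}$ whose square is crossed by a $D$ step of $\sigma$. An indifference graph on $[n]$ is a simple graph such that $\{i,l\}\in E$ implies $\{j,k\}\in E$ for $i\le j<k\le l$; for tall $\sigma$ and $S\subseteq\operatorname{Diag}(\sigma)$, $([n],\operatorname{Area}(\sigma)\cup S)$ is an indifference graph. For an indifference graph $\gamma$, $\mathrm{UT}_\gamma=\{g\in\mathrm{UT}_n:g_{i,j}=0$ for $i<j,\{i,j\}\in E(\gamma)\}$ and $\overline{\chi}^\gamma=\operatorname{Ind}^{\mathrm{UT}_n}_{\mathrm{UT}_\gamma}(\mathbbm{1})$.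 The pseudosupercharacter is $\psi^\sigma=\sum_{S\subseteq\operatorname{Diag}(\sigma)}(-1)^{|\operatorname{Diag}(\sigma)\setminus S|}\overline{\chi}^{([n],\operatorname{Area}(\sigma)\cup S)}$. The unipotent characters of $\mathrm{GL}_n$ are the irreducible constituents of $\operatorname{Ind}^{\mathrm{GL}_n}_{B_n}(\mathbbm{1})$; they are $\chi^\lambda$, $\lambda\vdash n$, indexed as in Macdonald's book (Ch. IV), i.e. so that for every partition $\mu$ of $n$ the multiplicity of $\chi^\lambda$ in $\operatorname{Ind}^{\mathrm{GL}_n}_{P_\mu}(\mathbbm{1})$ ($P_\mu$ the block upper triangular parabolic of block sizes $\mu$) is the Kostka number $K_{\lambda'\mu}$; in particular $\chi^{(1^n)}$ is trivial and $\chi^{(n)}$ is the Steinberg character. $\mathbf{p}_{\mathbbm{1}}(\psi)=\sum_{\lambda}\langle\psi,\chi^\lambda\rangle s_\lambda$ ($s_\lambda$ Schur functions). $\omega$ is the involution of symmetric functions with $\omega(s_\lambda)=s_{\lambda'}$. The vertical strip LLT polynomial is $G_\sigma(\mathbf{x};t)=\sum_{\kappa\in A(\sigma)}t^{\operatorname{asc}(\kappa)}x_{\kappa(1)}\cdots x_{\kappa(n)}$, where $A(\sigma)$ is the set of maps $\kappa:[n]\to\mathbb{Z}_{>0}$ with $\kappa(i)<\kappa(j)$ whenever $i<j$ and $\{i,j\}\in\operatorname{Diag}(\sigma)$, and $\operatorname{asc}(\kappa)=|\{\{i,j\}\in\operatorname{Area}(\sigma):i<j,\kappa(i)<\kappa(j)\}|$;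 $G_\sigma(\mathbf{x};q)$ is its evaluation at $t=q$ (a symmetric function). *)

(* Defs.v *)
From HB Require Import structures.
From mathcomp Require Import all_boot all_order all_algebra all_fingroup.
From mathcomp Require Import all_solvable all_field all_character.
From mathcomp.multinomials Require Import mpoly.
From Stdlib Require Import ClassicalEpsilon.

Set Implicit Arguments.
Unset Strict Implicit.
Unset Printing Implicit Defensive.

Import GroupScope GRing.Theory.
Local Open Scope ring_scope.

(** * Partitions, Schur functions and the involution omega *)

(* A partition of n is padded with zeros to exactly n parts. *)
Definition is_intpart n (la : {ffun 'I_n -> 'I_n.+1}) : bool :=
  [forall i : 'I_n, forall j : 'I_n, (i <= j)%N ==> (la j <= la i)%N]
  && (\sum_i la i == n)%N.

Record intpart (n : nat) := IntPart {
  intpart_val :> {ffun 'I_n -> 'I_n.+1};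
  intpartP : is_intpart intpart_val
}.

HB.instance Definition _ n := [isSub for @intpart_val n].
HB.instance Definition _ n := [Finite of intpart n by <:].

Definition conjpart_fun n (la : intpart n) : {ffun 'I_n -> 'I_n.+1} :=
  [ffun j : 'I_n => inord #|[set i : 'I_n | (j < la i)%N]|].

Lemma conjpart_funE n (la : intpart n) (j : 'I_n) :
  conjpart_fun la j = #|[set i : 'I_n | (j < la i)%N]| :> nat.
Proof.
by rewrite ffunE inordK // ltnS (leq_trans (max_card _)) // card_ord.
Qed.

Lemma conjpart_funP n (la : intpart n) : is_intpart (conjpart_fun la).
Proof.
apply/andP; split.
  apply/forallP => i; apply/forallP => j; apply/implyP => le_ij.
  rewrite !conjpart_funE subset_leq_card //; apply/subsetP => k.
  by rewrite !inE; apply: leq_ltn_trans.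
have /andP[_ /eqP sum_la] := intpartP la; apply/eqP; rewrite -[RHS]sum_la.
under eq_bigr => j _ do rewrite conjpart_funE -sum1_card big_mkcond /=.
rewrite exchange_big /=; apply: eq_bigr => i _.
under eq_bigr => j _ do rewrite inE.
rewrite -big_mkcond /= sum1_card -[RHS]card_ord.
have le_n : (la i <= n)%N by rewrite -ltnS.
have widen_inj : injective (widen_ord le_n).
  by move=> x y /(congr1 val) /= xy; apply: val_inj.
rewrite -(card_image widen_inj); apply: eq_card => j.
apply/idP/imageP => [lt_j | [k _ ->]]; last first.
  by rewrite unfold_in; apply: (ltn_ord k).
by exists (Ordinal (lt_j : (j < la i)%N)) => //; apply: val_inj.
Qed.

Definition conjpart n (la : intpart n) : intpart n := IntPart (conjpart_funP la).

(* The cell (i, j) is in row i and column j, in English notation. *)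
Definition cell n (la : intpart n) := {c : 'I_n * 'I_n | (c.2 < la c.1)%N}.

Definition ssyt n (la : intpart n) m (T : {ffun cell la -> 'I_m}) : bool :=
  [forall c : cell la, forall d : cell la,
    ((val c).1 == (val d).1) && ((val c).2 < (val d).2)%N ==> (T c <= T d)%N]
  && [forall c : cell la, forall d : cell la,
    ((val c).2 == (val d).2) && ((val c).1 < (val d).1)%N ==> (T c < T d)%N].

Definition Kostka n (la mu : intpart n) : nat :=
  #|[set T : {ffun cell la -> 'I_n} |
      ssyt T && [forall i : 'I_n, #|[set c | T c == i]| == mu i]]|.

(* A symmetric function f is given by its truncations f(x_1, ..., x_m) for all
   m; the ring of symmetric functions is (graded piece by graded piece) the
   inverse limit of the rings of symmetric polynomials in m variables, so an
   identity of symmetric functions is an identity of truncations for all m. *)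
Definition symfun := forall m : nat, {mpoly algC[m]}.

Definition schur n (la : intpart n) : symfun := fun m =>
  \sum_(T : {ffun cell la -> 'I_m} | ssyt T) \prod_c 'X_(T c).

Definition omega_graph (f g : symfun) : Prop :=
  exists (N : nat) (c : forall k, intpart k -> algC),
    (forall m, f m = \sum_(k < N) \sum_(la : intpart k) c k la *: schur la m)
    /\ (forall m,
          g m = \sum_(k < N) \sum_(la : intpart k) c k la *: schur (conjpart la) m).

(* The Schur functions form a linear basis of the symmetric functions, so the
   truncations of [omega f] are uniquely determined if f is symmetric; [omega]
   takes an unspecified value on the families that are not in their span. *)
Definition omega (f : symfun) : symfun := epsilon (inhabits f) (omega_graph f).

(** * Schröder paths *)

Inductive step := stepE | stepS | stepD.

Definition step_code (s : step) : option bool :=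
  match s with stepE => None | stepS => Some false | stepD => Some true end.
Definition step_decode (o : option bool) : step :=
  match o with None => stepE | Some false => stepS | Some true => stepD end.
Lemma step_codeK : cancel step_code step_decode.
Proof. by case. Qed.
HB.instance Definition _ := Equality.copy step (can_type step_codeK).

(* The point (x, y) reached after a sequence of steps starting at (0, 0) is
   represented by the natural numbers x and -y. *)
Definition abscissa (p : seq step) : nat := count (predC1 stepS) p.
Definition depth (p : seq step) : nat := count (predC1 stepE) p.

Definition schroder (n : nat) (p : seq step) : bool :=
  [&& abscissa p == n, depth p == n
    & all (fun k => depth (take k p) <= abscissa (take k p))%N
          (iota 0 (size p).+1)].

Definition tall (p : seq step) : bool :=
  [forall k : 'I_(size p), (nth stepE p k == stepD) ==>
     (depth (take k p) != abscissa (take k p))].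

(* The edge {i, j} of a graph on [n] is represented by the pair (i, j) with
   i < j.  Vertices are numbered from 0, so the unit square of (i, j) is
   [j, j + 1] x [-i - 1, -i]. *)

(* The square lies below the path iff the unique E or D step over [j, j + 1]
   ends at height at least -i. *)
Definition Area n (p : seq step) : {set 'I_n * 'I_n} :=
  [set e : 'I_n * 'I_n | (e.1 < e.2)%N &&
    [exists k : 'I_(size p), [&& nth stepE p k != stepS, abscissa (take k p) == e.2
                               & (depth (take k.+1 p) <= e.1)%N]]].

(* A D step crosses the square whose upper left corner is its origin. *)
Definition Diag n (p : seq step) : {set 'I_n * 'I_n} :=
  [set e : 'I_n * 'I_n | (e.1 < e.2)%N &&
    [exists k : 'I_(size p), [&& nth stepE p k == stepD, abscissa (take k p) == e.2
                               & depth (take k p) == e.1]]].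

Definition indifference n (A : {set 'I_n * 'I_n}) : Prop :=
  (forall i j, (i, j) \in A -> (i < j)%N) /\
  forall i j k l : 'I_n, (i <= j)%N -> (j < k)%N -> (k <= l)%N ->
    (i, l) \in A -> (j, k) \in A.

Lemma count_take_mono (T : Type) (a : pred T) (s : seq T) i j :
  (i <= j)%N -> (count a (take i s) <= count a (take j s))%N.
Proof.
by move=> le_ij; rewrite -(subnKC le_ij) takeD count_cat leq_addr.
Qed.

Lemma column_step (p : seq step) t k :
    (t <= size p)%N -> (k < abscissa (take t p))%N ->
  exists2 s, (s < t)%N & (nth stepE p s != stepS) && (abscissa (take s p) == k).
Proof.
elim: t => [|t IHt] lt_t; first by rewrite take0.
rewrite (take_nth stepE lt_t) /abscissa -cats1 count_cat /= addn0.
have [lt_k _ | le_k] := ltnP k (abscissa (take t p)).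
  by have [s lt_s Hs] := IHt (ltnW lt_t) lt_k; exists s => //; apply: ltnW.
rewrite /abscissa in le_k; case: (nth stepE p t =P stepS) => /= [_|/eqP neq lt_k].
  by rewrite addn0 ltnNge le_k.
exists t; rewrite // neq /abscissa eqn_leq le_k /= -ltnS.
by move: lt_k; rewrite addn1.
Qed.

Lemma area_diag_indifference n (p : seq step) (A : {set 'I_n * 'I_n}) :
  A \subset Diag n p -> indifference (Area n p :|: A).
Proof.
move=> /subsetP sAD; split=> [i j|i j k l le_ij lt_jk le_kl].
  by rewrite inE => /orP[|/sAD]; rewrite inE => /andP[].
suff key : (exists2 t : 'I_(size p), nth stepE p t != stepS &
      (abscissa (take t p) == l) &&
      (((k < l) && (depth (take t p) <= j)) || (depth (take t.+1 p) <= j))%N)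
    -> (j, k) \in Area n p.
  rewrite !in_setU => /orP[|in_A].
    rewrite {1}inE /= => /andP[_ /existsP[t /and3P[nS xt dt]]].
    rewrite key //; exists t => //; rewrite xt (leq_trans dt le_ij) orbT //.
  have := sAD _ in_A.
  rewrite {1}inE /= => /andP[_ /existsP[t /and3P[/eqP isD xt /eqP dt]]].
  have nS : nth stepE p t != stepS by rewrite isD.
  have [eq_kl|neq_kl] := eqVneq k l; last first.
    rewrite key //; exists t => //; rewrite xt dt le_ij andbT /=.
    by rewrite ltn_neqAle neq_kl le_kl.
  subst l; have [eq_ij|neq_ij] := eqVneq i j; first by rewrite -eq_ij in_A orbT.
  rewrite key //; exists t => //; rewrite xt ltnn /= (take_nth stepE (ltn_ord t)).
  rewrite /depth -cats1 count_cat isD /= addn1.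
  by rewrite -[count _ _]/(depth _) dt ltn_neqAle neq_ij le_ij.
case=> t nS /andP[/eqP xt dt]; rewrite inE /= lt_jk /=.
have [eq_kl|neq_kl] := eqVneq k l.
  subst l; rewrite ltnn /= in dt.
  by apply/existsP; exists t; rewrite nS xt eqxx.
have lt_kl : (k < l)%N by rewrite ltn_neqAle neq_kl le_kl.
have dt' : (depth (take t p) <= j)%N.
  case/orP: dt => [/andP[] // | ]; apply: leq_trans.
  by apply: count_take_mono.
have lt_kx : (k < abscissa (take t p))%N by rewrite xt.
have [s lt_st /andP[nSs xs]] := column_step (ltnW (ltn_ord t)) lt_kx.
apply/existsP; exists (Ordinal (ltn_trans lt_st (ltn_ord t))).
rewrite nSs xs /= (leq_trans _ dt') //; exact: count_take_mono.
Qed.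

(** * GL_n and its subgroups *)

(* [{'GL_n[F]}] is built on matrices of size n.-1.+1, hence is wrong for
   n = 0; the following version is uniform in n. *)
Record GL (F : finFieldType) (n : nat) := MkGL {
  GLmx :> 'M[F]_n;
  GLmx_unit : GLmx \in unitmx
}.

HB.instance Definition _ F n := [isSub for @GLmx F n].
HB.instance Definition _ F n := [Finite of GL F n by <:].

Section GLGroup.
Variables (F : finFieldType) (n : nat).

Lemma GL_one_unit : (1%:M : 'M[F]_n) \in unitmx.
Proof. exact: unitmx1. Qed.
Lemma GL_mul_unit (g h : GL F n) : (g : 'M_n) *m h \in unitmx.
Proof. by rewrite unitmx_mul !GLmx_unit. Qed.
Lemma GL_inv_unit (g : GL F n) : invmx (g : 'M_n) \in unitmx.
Proof. by rewrite unitmx_inv GLmx_unit. Qed.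

Definition GL_one : GL F n := MkGL GL_one_unit.
Definition GL_mul (g h : GL F n) : GL F n := MkGL (GL_mul_unit g h).
Definition GL_inv (g : GL F n) : GL F n := MkGL (GL_inv_unit g).

Lemma GL_mulA : associative GL_mul.
Proof. by move=> x y z; apply: val_inj; rewrite /= mulmxA. Qed.
Lemma GL_mul1 : left_id GL_one GL_mul.
Proof. by move=> x; apply: val_inj; rewrite /= mul1mx. Qed.
Lemma GL_mulV : left_inverse GL_one GL_inv GL_mul.
Proof. by move=> x; apply: val_inj; rewrite /= mulVmx // GLmx_unit. Qed.

HB.instance Definition _ :=
  Finite_isGroup.Build (GL F n) GL_mulA GL_mul1 GL_mulV.

Lemma GL_mulE (g h : GL F n) (i j : 'I_n) :
  (g * h)%g i j = \sum_k g i k * h k j.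
Proof. by rewrite [LHS]mxE. Qed.

Lemma GL_oneE (i j : 'I_n) : (1 : GL F n)%g i j = (i == j)%:R.
Proof. by rewrite [LHS]mxE. Qed.

(* Block upper triangular matrices, where b i is the index of the block
   containing the row i. *)
Definition parabolic (b : 'I_n -> nat) : {set GL F n} :=
  [set g : GL F n | [forall i : 'I_n, forall j : 'I_n, (b j < b i)%N ==> (g i j == 0)]].

Lemma parabolic_group_set b : group_set (parabolic b).
Proof.
apply/group_setP; split=> [|g h]; rewrite !inE.
  apply/'forall_forallP => i j; apply/implyP => lt_ji; rewrite GL_oneE.
  have [eq_ij|//] := eqVneq i j; by rewrite eq_ij ltnn in lt_ji.
move=> /'forall_forallP Hg /'forall_forallP Hh.
apply/'forall_forallP => i j; apply/implyP => lt_ji.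
rewrite GL_mulE big1 // => k _.
have [lt_ki|le_ik] := ltnP (b k) (b i).
  by rewrite (eqP (implyP (Hg i k) lt_ki)) mul0r.
by rewrite (eqP (implyP (Hh k j) (leq_trans lt_ji le_ik))) mulr0.
Qed.
Canonical parabolic_group b := Group (parabolic_group_set b).

Definition Borel : {set GL F n} := parabolic (@nat_of_ord n).
Canonical Borel_group := [group of Borel].

Definition block_of (mu : intpart n) (i : 'I_n) : nat :=
  #|[set r : 'I_n | (\sum_(s < n | s <= r) mu s <= i)%N]|.

Definition UT_graph (A : {set 'I_n * 'I_n}) : {set GL F n} :=
  [set g : GL F n |
    [forall i : 'I_n, forall j : 'I_n,
      [&& (i == j) ==> (g i j == 1),
                             (j < i)%N ==> (g i j == 0)
                           & ((i < j)%N && ((i, j) \in A)) ==> (g i j == 0)]]].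

Lemma UT_graph_group_set A : indifference A -> group_set (UT_graph A).
Proof.
case=> _ indA; apply/group_setP; split=> [|g h]; rewrite !inE.
  apply/'forall_forallP => i j; rewrite GL_oneE -val_eqE /=.
  by case: ltngtP => //= _; rewrite ?eqxx ?implybT.
move=> /'forall_forallP Hg /'forall_forallP Hh.
apply/'forall_forallP => i j; rewrite GL_mulE.
have g1 k : g k k = 1 by have /and3P[/implyP/(_ (eqxx _))/eqP] := Hg k k.
have h1 k : h k k = 1 by have /and3P[/implyP/(_ (eqxx _))/eqP] := Hh k k.
have g0 (k l : 'I_n) : (l < k)%N -> g k l = 0.
  by move=> lt; have /and3P[_ /implyP/(_ lt)/eqP] := Hg k l.
have h0 (k l : 'I_n) : (l < k)%N -> h k l = 0.
  by move=> lt; have /and3P[_ /implyP/(_ lt)/eqP] := Hh k l.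
have gA (k l : 'I_n) : (k < l)%N -> (k, l) \in A -> g k l = 0.
  by move=> lt kl; have /and3P[_ _ /implyP] := Hg k l; rewrite lt kl => /(_ isT)/eqP.
have hA (k l : 'I_n) : (k < l)%N -> (k, l) \in A -> h k l = 0.
  by move=> lt kl; have /and3P[_ _ /implyP] := Hh k l; rewrite lt kl => /(_ isT)/eqP.
apply/and3P; split; apply/implyP.
- move/eqP=> <-; rewrite (bigD1 i) //= g1 h1 mulr1 big1 ?addr0 // => k.
  rewrite -val_eqE /= neq_ltn => /orP[lt|lt]; first by rewrite g0 ?mul0r.
  by rewrite h0 ?mulr0.
- move=> lt; rewrite big1 // => k _; have [lt_ki|le_ik] := ltnP k i.
    by rewrite g0 ?mul0r.
  by rewrite h0 ?mulr0 // (leq_trans lt).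
case/andP=> lt_ij Aij; rewrite big1 // => k _.
have [lt_ki|lt_ik|/val_inj eq_ik] := ltngtP k i.
- by rewrite g0 ?mul0r.
- have [lt_jk|le_kj] := ltnP j k; first by rewrite h0 ?mulr0.
  by rewrite gA ?mul0r // (indA i i k j).
- by rewrite eq_ik hA ?mulr0.
Qed.

Lemma indifference0 : indifference (set0 : {set 'I_n * 'I_n}).
Proof. by split=> [i j | i j k l _ _ _]; rewrite !inE. Qed.

Definition UT : {set GL F n} := UT_graph set0.
Canonical UT_group := Group (UT_graph_group_set indifference0).

(** * Characters *)

(* [UT_graph A] is a group, hence equal to the group it generates, if A is an
   indifference graph (see [UT_graph_group_set]). *)
Definition chibar (A : {set 'I_n * 'I_n}) : 'CF(UT) :=
  'Ind[UT] (1 : 'CF(<<UT_graph A>>)).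

Definition psi (p : seq step) : 'CF(UT) :=
  \sum_(A in powerset (Diag n p))
    (-1) ^+ #|Diag n p :\: A| *: chibar (Area n p :|: A).

(* [chi] is the indexing of the unipotent characters of GL_n by the partitions
   of n for which chi (1^n) is trivial and chi (n) is the Steinberg
   character. *)
Definition unipotent_indexing (chi : intpart n -> Iirr [set: GL F n]) : Prop :=
  [/\ injective chi,
      forall i, (i \in irr_constt ('Ind[[set: GL F n]] (1 : 'CF(Borel))))
                <-> exists la, i = chi la
    & forall la mu : intpart n,
        '['Ind[[set: GL F n]] (1 : 'CF(parabolic (block_of mu))),
          'chi_(chi la)] = (Kostka (conjpart la) mu)%:R].

Definition p_one (chi : intpart n -> Iirr [set: GL F n])
    (phi : 'CF([set: GL F n])) : symfun := fun m =>
  \sum_(la : intpart n) '[phi, 'chi_(chi la)] *: schur la m.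

End GLGroup.

(** * Vertical strip LLT polynomials *)

Definition asc n (p : seq step) m (kappa : {ffun 'I_n -> 'I_m}) : nat :=
  #|[set e in Area n p | (kappa e.1 < kappa e.2)%N]|.

Definition LLT n (p : seq step) (t : algC) : symfun := fun m =>
  \sum_(kappa : {ffun 'I_n -> 'I_m} |
          [forall e in Diag n p, (kappa e.1 < kappa e.2)%N])
    t ^+ asc p kappa *: \prod_i 'X_(kappa i).

(* Main.v *)
(** The unipotent multiplicities of a class function phi of GL_n are encoded in
    its scalar products with the permutation characters on flags: by the
    normalisation of the indexing, the coefficient of [x^mu] in
    [omega (p_one phi)] is [<phi, Ind_{P_mu} 1>].

    For phi induced from [UT_gamma], the Bruhat decomposition into cells
    [UT w P] indexed by the words kappa of content mu, together with the
    normality of [UT_gamma] in [UT], gives the sum over kappa of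
    [q^(number of inversions of kappa in gamma)]; the alternating sum over the
    subsets of Diag then factors as [(q - 1)^|Diag|] times the LLT weight.

    The order of the blocks of P does not matter: scalar products of two such
    permutation characters count double cosets of Young subgroups, so the
    difference of the characters of two parabolic subgroups with the same
    blocks has norm zero.  On the side of Schur functions the same symmetry is
    the Bender-Knuth involution. *)
Require Import Defs.
From mathcomp Require Import zify ring.
From mathcomp Require Import all_boot all_order all_algebra all_fingroup.
From mathcomp Require Import all_solvable all_field all_character.
From mathcomp.multinomials Require Import mpoly.

Import GroupScope GRing.Theory Num.Theory.
Local Open Scope ring_scope.

Set Implicit Arguments.
Unset Strict Implicit.
Unset Printing Implicit Defensive.

(** * Scalar products of permutation characters *)

Section DoubleCosetSums.
Variables (gT : finGroupType) (H K : {group gT}).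

(** Frobenius reciprocity moves the pairing to [H]; the formula for induced class functions then
    leaves a count of the [h] in [H] conjugated into [K] by [x]. *)
Lemma cfdot_Ind_cfun1 :
  '['Ind[[set: gT]] (1 : 'CF(H)), 'Ind[[set: gT]] (1 : 'CF(K))]
  = (#|H|%:R * #|K|%:R)^-1 * \sum_(x : gT) #|[set h in H | (h ^ x)%g \in K]|%:R.
Proof.
rewrite -Frobenius_reciprocity cfdotE invfM -!mulrA; congr (_ * _).
rewrite (eq_bigr (fun h => #|K|%:R^-1 * \sum_(x : gT) ((h ^ x)%g \in K)%:R)).
  rewrite -big_distrr /= exchange_big /=; congr (_ * _); apply: eq_bigr => x _.
  rewrite -sum1_card natr_sum [in LHS]big_mkcond [in RHS]big_mkcond /=.
  by apply: eq_bigr => h _; rewrite inE; case: (h \in H); case: (_ \in K).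
move=> h Hh; rewrite cfun1E Hh mul1r cfResE ?subsetT //.
rewrite cfIndE ?subsetT // rmorphM /= fmorphV /= conjC_nat rmorph_sum /=.
congr (_ * _); apply: eq_big => [x|x _]; first by rewrite inE.
by rewrite cfun1E conjC_nat.
Qed.

Variables (I : finType) (w : I -> gT).

Definition same_dcoset (s t : I) : bool :=
  [exists h in H, exists k in K, (h * w s * k == w t)%g].

(** The [w s] meet every double coset but may represent one several times, as permutation matrices
    do for parabolic subgroups; sums over [s] therefore carry the inverse of the number of
    repetitions. *)
Hypothesis cover : forall x, exists h k s,
  [/\ h \in H, k \in K & (h * x * k = w s)%g].

(** This counts the triples [(s, h, k)] that carry [x] to a representative. It is nonzero by
    [cover], so a sum over [x] can be spread evenly over these triples. *)
Let N (x : gT) : algC :=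
  \sum_s \sum_(h in H) \sum_(k in K) (h * x * k == w s)%g%:R.

Let N_neq0 x : N x != 0.
Proof.
have [h [k [s [Hh Kk e]]]] := cover x.
have -> : N x = (\sum_s \sum_(h in H) \sum_(k in K) (h * x * k == w s)%g)%N%:R.
  rewrite natr_sum; apply: eq_bigr => s' _; rewrite natr_sum.
  by apply: eq_bigr => h' _; rewrite natr_sum.
rewrite pnatr_eq0 (bigD1 s) //= (bigD1 h) //= (bigD1 k) //=.
by rewrite e eqxx.
Qed.

Let N_inv x h k : h \in H -> k \in K -> N (h * x * k)%g = N x.
Proof.
move=> Hh Kk; apply: eq_bigr => s _.
rewrite [RHS](reindex_inj (mulIg h)) /=.
apply: eq_big => [h'|h' Hh']; first by rewrite groupMr.
rewrite [RHS](reindex_inj (mulgI k)) /=.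
apply: eq_big => [k'|k' _]; first by rewrite groupMl.
by rewrite !mulgA.
Qed.

(** For each [t] in the class of [s], the pairs [(h, k)] carrying [w s] to [w t] form a coset of the
    stabilizer of [w s] in [H] times [K], which projects bijectively onto the set of [h] with
    [h ^ w s] in [K]. *)
Let N_w s :
  N (w s) = #|[set t | same_dcoset s t]|%:R * #|[set h in H | (h ^ w s)%g \in K]|%:R.
Proof.
rewrite -sum1_card natr_sum mulr_suml big_mkcond /=.
apply: eq_bigr => t _; rewrite inE; case: ifP => [|/negbT noE]; last first.
  rewrite big1 // => h Hh; rewrite big1 // => k Kk.
  case: eqP => // e; case/negP: noE.
  by apply/exists_inP; exists h => //; apply/exists_inP; exists k => //; apply/eqP.
case/exists_inP=> h0 Hh0 /exists_inP[k0 Kk0 /eqP e0].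
rewrite mul1r -sum1_card natr_sum.
rewrite (reindex_inj (mulgI h0)) /= (reindex_inj invg_inj) /=.
rewrite [RHS]big_mkcond [LHS]big_mkcond; apply: eq_bigr => h _ /=.
rewrite inE groupMl // groupV; case: ifP => //= Hh.
rewrite (reindex_inj (mulIg k0)) /=.
rewrite (eq_bigr (fun k => (k == (h ^ w s)%g)%:R)) => [|k _]; last first.
  rewrite -e0 !mulgA (inj_eq (mulIg _)) -!mulgA (inj_eq (mulgI _)).
  by rewrite -[in RHS](inj_eq (mulgI (h^-1 * w s)%g)) conjgE !mulgA mulgK mulVg mul1g.
case: ifP => KK.
  rewrite (bigD1 (h ^ w s)%g) /=; last by rewrite groupMr.
  by rewrite eqxx big1 ?addr0 // => k /andP[_ /negbTE->].
rewrite big1 // => k; rewrite groupMr // => Kk; case: eqP => // e.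
by rewrite -e Kk in KK.
Qed.

(** Spread [phi x] over the triples counted by [N x] and exchange the sums: for fixed [s], [h], [k]
    exactly one [x] survives, and by invariance it contributes [phi (w s) / N (w s)]. *)
Lemma sum_dcosets (phi : gT -> algC) :
    (forall x h k, h \in H -> k \in K -> phi (h * x * k)%g = phi x) ->
  \sum_x phi x = #|H|%:R * #|K|%:R *
    \sum_s phi (w s) / (#|[set t | same_dcoset s t]|%:R
                        * #|[set h in H | (h ^ w s)%g \in K]|%:R).
Proof.
move=> phi_inv.
transitivity (\sum_x \sum_s \sum_(h in H) \sum_(k in K)
    (h * x * k == w s)%g%:R * (phi x / N x)).
  apply: eq_bigr => x _; rewrite -[LHS](mulfVK (N_neq0 x)) mulrC {1}/N.
  by do 3![rewrite mulr_suml; apply: eq_bigr => ? _].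
rewrite exchange_big mulr_sumr; apply: eq_bigr => s _ /=.
rewrite exchange_big /= -N_w.
rewrite (eq_bigr (fun=> #|K|%:R * (phi (w s) / N (w s)))) => [|h Hh].
  by rewrite sumr_const -[LHS]mulr_natl mulrA.
rewrite exchange_big /= (eq_bigr (fun=> phi (w s) / N (w s))) => [|k Kk].
  by rewrite sumr_const -[LHS]mulr_natl.
rewrite (bigD1 (h^-1 * w s * k^-1)%g) //= big1 => [|x neq].
  rewrite !mulgA mulgV mul1g mulgKV eqxx mul1r addr0.
  by rewrite phi_inv ?N_inv ?groupV.
case: eqP => [e|]; rewrite ?mul0r //.
by rewrite -e -!mulgA mulKg mulgV mulg1 eqxx in neq.
Qed.

(** The sum is the number of double cosets: the indices representing one coset have weights adding
    up to 1. *)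
Lemma cfdot_Ind_cfun1_dcosets :
  '['Ind[[set: gT]] (1 : 'CF(H)), 'Ind[[set: gT]] (1 : 'CF(K))]
  = \sum_s #|[set t | same_dcoset s t]|%:R^-1.
Proof.
rewrite cfdot_Ind_cfun1 sum_dcosets => [|x h k Hh Kk].
  rewrite mulKf ?mulf_neq0 ?neq0CG //; apply: eq_bigr => s _.
  rewrite invfM mulrCA mulfV ?mulr1 // pnatr_eq0 -lt0n card_gt0.
  by apply/set0Pn; exists 1%g; rewrite !inE group1 conj1g group1.
congr (_%:R); rewrite -[RHS](card_imset _ (conjg_inj (h^-1)%g)); congr #|pred_of_set _|.
apply/setP => g; apply/idP/imsetP => [|[g' /[!inE] /andP[Hg' Kg'] ->]].
  rewrite !inE !conjgM groupJr // => /andP[Hg Kg]; exists (g ^ h)%g; last by rewrite conjgK.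
  by rewrite inE groupJr // Hg.
by rewrite groupJ ?groupV //= -!conjgM !mulgA mulVg mul1g conjgM groupJ.
Qed.

End DoubleCosetSums.

(** * Bruhat decomposition *)

Section Bruhat.
Variables (F : finFieldType) (n : nat).
Implicit Types (b : 'I_n -> nat) (s t : 'S_n) (g : GL F n).

Lemma parabolicP b g :
  reflect (forall i j, (b j < b i)%N -> g i j = 0) (g \in parabolic F b).
Proof.
rewrite inE; apply: (iffP 'forall_forallP) => gP i j.
  by move=> lt; apply/eqP; exact: (implyP (gP i j)).
by apply/implyP => lt; apply/eqP; exact: gP.
Qed.

Lemma parabolic_neq0 b g i j : g \in parabolic F b -> g i j != 0 -> (b i <= b j)%N.
Proof. by move/parabolicP=> gP; apply: contraR; rewrite -ltnNge => /gP->. Qed.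

Definition GLperm s : GL F n := MkGL (unitmx_perm F s).

Lemma GLpermE s i j : GLperm s i j = (s i == j)%:R.
Proof. by rewrite /= !mxE. Qed.

Lemma GLpermM s t : GLperm (s * t) = (GLperm s * GLperm t)%g.
Proof. by apply: val_inj; rewrite /= perm_mxM. Qed.

Lemma GLperm_mull s g i j : (GLperm s * g)%g i j = g (s i) j.
Proof.
rewrite GL_mulE (bigD1 (s i)) //= GLpermE eqxx mul1r big1 ?addr0 // => k.
by rewrite GLpermE eq_sym => /negbTE->; rewrite mul0r.
Qed.

Lemma GLperm_mulr s g i j : (g * GLperm s)%g i (s j) = g i j.
Proof.
rewrite GL_mulE (bigD1 j) //= GLpermE eqxx mulr1 big1 ?addr0 // => k.
by rewrite GLpermE (inj_eq perm_inj) => /negbTE->; rewrite mulr0.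
Qed.

Lemma GLperm_conj s g i j : (g ^ GLperm s)%g (s i) (s j) = g i j.
Proof.
have e : (GLperm s * g ^ GLperm s = g * GLperm s)%g by rewrite -conjgC.
by rewrite -GLperm_mull e GLperm_mulr.
Qed.

Lemma parabolic_conj b s g :
  (g ^ GLperm s \in parabolic F b)%g = (g \in parabolic F (b \o s)).
Proof.
apply/parabolicP/parabolicP => gP i j.
  by move/gP; rewrite GLperm_conj.
by rewrite -[i](permKV s) -[j](permKV s) GLperm_conj; apply: gP.
Qed.

(** Right multiplication by this matrix scales column [k] and adds multiples of it to the other
    columns; its transpose acts on rows from the left. *)
Definition rowmx (k : 'I_n) (r : 'I_n -> F) : 'M[F]_n :=
  \matrix_(i, j) if i == k then r j else (i == j)%:R.

Lemma mul_rowmx k r (A : 'M[F]_n) i j :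
  (A *m rowmx k r) i j = A i k * r j + (j != k)%:R * A i j.
Proof.
rewrite mxE (bigD1 k) //= mxE eqxx; congr (_ + _).
rewrite (eq_bigr (fun l => A i l * (l == j)%:R)) => [|l /negbTE nlk]; last first.
  by rewrite mxE nlk.
have [->|njk] := eqVneq j k.
  by rewrite mul0r big1 // => l /negbTE->; rewrite mulr0.
rewrite (bigD1 j) //= eqxx mulr1 mul1r big1 ?addr0 // => l /andP[_ /negbTE->].
by rewrite mulr0.
Qed.

Lemma rowmx_unit k r : r k != 0 -> rowmx k r \in unitmx.
Proof.
move=> rk; pose r' j := if j == k then (r k)^-1 else - (r j / r k).
suff : rowmx k r' *m rowmx k r = 1%:M by case/mulmx1_unit.
apply/matrixP => i j; rewrite mul_rowmx !mxE /r' eqxx.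
have [->|nik] := eqVneq i k; have [->|njk] := eqVneq j k; rewrite ?eqxx /=.
- by rewrite mulVf // mul0r addr0.
- by rewrite mulrC mul1r subrr.
- by rewrite !mul0r addr0 (negbTE nik).
- by rewrite mul0r add0r mul1r.
Qed.

Variables (b1 b2 : 'I_n -> nat) (H : {group GL F n}).
(** These are the row operations used by the elimination. Both the parabolic subgroup of [b1] and,
    with [b1] the row number, the group [UT] contain them, so one elimination serves both
    decompositions. *)
Hypothesis col_in_H : forall (u : GL F n) (i0 : 'I_n),
    (forall i j, j != i0 -> u i j = (i == j)%:R) -> u i0 i0 = 1 ->
    (forall i, u i i0 != 0 -> (b1 i <= b1 i0)%N) ->
  u \in H.

(* Gaussian elimination: the columns in J are already cleared.  Processing the
   columns by increasing b2 and choosing pivots with maximal b1 keeps the row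
   operations in H and the column operations in the parabolic subgroup. *)
Lemma elimination (J : {set 'I_n}) (f : 'I_n -> 'I_n) (x : GL F n) :
    (forall j, j \in J -> forall i, x i j = (i == f j)%:R) ->
    (forall j, j \in J -> forall j', j' != j -> x (f j) j' = 0) ->
  exists h k s, [/\ h \in H, k \in parabolic F b2 & (h * x * k)%g = GLperm s].
Proof.
have [c] := ubnP #|~: J|; elim: c J f x => // c IHc J f x le_c xJ x0.
have [J0|/set0Pn[k0 k0J]] := eqVneq (~: J) set0.
  have inJ j : j \in J by rewrite -[j \in J]negbK -in_setC J0 inE.
  have f_inj : injective f.
    move=> j j' e; apply/eqP/negPn/negP => nej.
    have := x0 j (inJ j) j'; rewrite eq_sym => /(_ nej).
    by rewrite (xJ j') // e eqxx => /eqP; rewrite oner_eq0.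
  (* Column [j] has its 1 in row [f j], whereas [GLperm s] has the 1 of row [i] in column [s i];
     hence the inverse. *)
  exists 1%g, 1%g, (perm f_inj)^-1%g; split; rewrite ?group1 //.
  apply: val_inj; apply/matrixP => i j; rewrite mulg1 mul1g GLpermE xJ //.
  by rewrite -[in RHS](inj_eq (@perm_inj _ (perm f_inj))) permKV permE.
rewrite inE in k0J.
have [k kJ k_min] := @arg_minnP _ k0 (fun j => j \notin J) b2 k0J.
have [i1 xi1] : exists i, x i k != 0.
  apply/existsP; apply: contraT; rewrite negb_exists => /forallP xk0.
  have := congr1 (fun A : 'M_n => A k k) (mulVmx (GLmx_unit x)).
  rewrite mxE big1 => [|i _]; last by have /negPn/eqP-> := xk0 i; rewrite mulr0.
  by rewrite mxE eqxx => /eqP; rewrite eq_sym oner_eq0.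
have [i0 xi0 i0_max] := @arg_maxnP _ i1 (fun i => x i k != 0) b1 xi1.
set a := x i0 k in xi0.
have neq_kJ j : j \in J -> k != j by move=> jJ; apply: contraNneq kJ => ->.
have neq_i0J j : j \in J -> i0 != f j.
  move=> jJ; apply: contraNneq xi0 => e.
  by rewrite /a e x0 ?neq_kJ.
have xi0J j : j \in J -> x i0 j = 0.
  by move=> jJ; rewrite xJ // (negbTE (neq_i0J j jJ)).
(* Left multiplication by [u] clears column [k] outside the pivot row [i0]. *)
pose cu i := if i == i0 then 1 else - (x i k / a).
have uU : (rowmx i0 cu)^T \in unitmx.
  by rewrite unitmx_tr rowmx_unit // /cu eqxx oner_eq0.
pose u : GL F n := MkGL uU.
(* Right multiplication by [p] makes the pivot 1 and clears the rest of row [i0]. The columns in [J]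
   already vanish there, so only columns with [b2] at least [b2 k] are changed. *)
pose rp j := if j == k then a^-1 else - (x i0 j / a).
have pU : rowmx k rp \in unitmx by rewrite rowmx_unit // /rp eqxx invr_eq0.
pose p : GL F n := MkGL pU.
have uE i j : u i j = if j == i0 then cu i else (i == j)%:R.
  by rewrite /= !mxE (eq_sym i j).
have Hu : u \in H.
  apply: (col_in_H (i0 := i0)) => [i j /negbTE nj||i]; rewrite uE ?nj ?eqxx //.
    by rewrite /cu eqxx.
  rewrite /cu; have [->//|_] := eqVneq i i0.
  rewrite oppr_eq0 mulf_eq0 negb_or => /andP[xik _]; exact: i0_max.
have Qp : p \in parabolic F b2.
  apply/parabolicP => i j lt_ji; rewrite /= mxE.
  have neq_ij : i != j by apply: contraTneq lt_ji => ->; rewrite ltnn.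
  have [eik|_] := eqVneq i k; last by rewrite (negbTE neq_ij).
  rewrite /rp -eik eq_sym (negbTE neq_ij) xi0J ?mul0r ?oppr0 //.
  apply: contraLR lt_ji => jJ; rewrite -leqNgt eik.
  exact: k_min.
have yE i j : (u * x)%g i j
    = if i == i0 then x i0 j else x i j - x i k / a * x i0 j.
  rewrite GL_mulE (bigD1 i0) //= -[fun_of_matrix _ i i0]/(u i i0) uE eqxx /cu.
  have [->|nii0] := eqVneq i i0.
    rewrite mul1r big1 ?addr0 // => l nl.
    by rewrite -[fun_of_matrix _ _ l]/(u _ l) uE (negbTE nl) eq_sym (negbTE nl) mul0r.
  rewrite (bigD1 i) //= big1 => [|l /andP[nl nli]].
    rewrite -[fun_of_matrix _ i i]/(u i i) uE (negbTE nii0) eqxx mul1r addr0.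
    by rewrite mulNr addrC.
  by rewrite -[fun_of_matrix _ i l]/(u i l) uE (negbTE nl) eq_sym (negbTE nli) mul0r.
have x'E i j : (u * x * p)%g i j = if j == k then (i == i0)%:R else
    if i == i0 then 0 else x i j - x i k / a * x i0 j.
  rewrite [LHS]mul_rowmx.
  rewrite -[fun_of_matrix _ i k]/((u * x)%g i k) -[fun_of_matrix _ i j]/((u * x)%g i j).
  rewrite !yE /rp; have [->|njk] := eqVneq j k.
    rewrite /= mul0r addr0; case: ifP => _; first by rewrite mulfV.
    by rewrite mulfVK // subrr mul0r.
  case: ifP => _; first by rewrite mulrN mulrCA mulfV // mulr1 mul1r addNr.
  by rewrite mulfVK // subrr mul0r add0r mul1r.
pose f' j := if j == k then i0 else f j.
have lt_c : (#|~: (k |: J)| < c)%N.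
  rewrite -ltnS (leq_trans _ le_c) // ltnS; apply: proper_card.
  apply/properP; split; first by rewrite setCS subsetUr.
  by exists k; rewrite !inE ?eqxx ?(negbTE kJ).
have [j|j|h [k' [s [Hh Kk' e]]]] := IHc (k |: J) f' (u * x * p)%g lt_c.
- rewrite /f' !inE => /predU1P[-> i|jJ i]; first by rewrite x'E eqxx.
  have := neq_kJ j jJ; rewrite eq_sym => /negbTE njk.
  rewrite x'E njk; case: eqP => [->|_]; first by rewrite (negbTE (neq_i0J j jJ)).
  by rewrite xi0J // mulr0 subr0 xJ.
- rewrite /f' !inE => /predU1P[-> j' nj'|jJ j' nj'].
    by rewrite x'E (negbTE nj') !eqxx.
  have := neq_kJ j jJ; rewrite eq_sym => /negbTE njk.
  have := neq_i0J j jJ; rewrite eq_sym => /negbTE nfi0.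
  rewrite x'E njk nfi0 !x0 ?mul0r ?subrr ?neq_kJ //; by case: eqP.
exists (h * u)%g, (p * k')%g, s; split; rewrite ?groupM //.
by rewrite -e !mulgA.
Qed.

Lemma Bruhat_cover (x : GL F n) :
  exists h k s, [/\ h \in H, k \in parabolic F b2 & (h * x * k)%g = GLperm s].
Proof. by apply: (@elimination set0 id) => j; rewrite inE. Qed.

End Bruhat.

(** * Parabolic and unitriangular subgroups *)

Section Parabolics.
Variables (F : finFieldType) (n : nat).
Implicit Types (b : 'I_n -> nat) (s t : 'S_n) (g : GL F n) (A : {set 'I_n * 'I_n}).

Lemma sum_leq_eq (I : finType) (a c : I -> nat) :
  (forall i, a i <= c i)%N -> (\sum_i a i = \sum_i c i)%N -> forall i, a i = c i.
Proof.
move=> le_ac e i; apply/eqP; rewrite eqn_leq le_ac /= leqNgt; apply/negP => lt.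
have : (\sum_i a i < \sum_i c i)%N; last by rewrite e ltnn.
rewrite (bigD1 i) //= [X in (_ < X)%N](bigD1 i) //= -addSn leq_add //.
by apply: leq_sum.
Qed.

(** Both sides have the same sum over [i], so no inequality can be strict. This turns the
    inequalities given by block triangularity into equalities. *)
Lemma perm_leq_eq b s t : (forall i, b (s i) <= b (t i))%N ->
  forall i, b (s i) = b (t i).
Proof.
move=> le; apply: sum_leq_eq le _.
have e s0 : (\sum_i b (s0 i) = \sum_i b i)%N by rewrite [RHS](reindex_perm s0).
by rewrite !e.
Qed.

Lemma UT_graphP A g :
  reflect [/\ forall i, g i i = 1, forall i j : 'I_n, (j < i)%N -> g i j = 0
            & forall i j : 'I_n, (i < j)%N -> (i, j) \in A -> g i j = 0]
          (g \in UT_graph F A).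
Proof.
rewrite inE; apply: (iffP 'forall_forallP) => [gP|[g1 g0 gA] i j].
  split=> [i|i j lt|i j lt Aij]; apply/eqP.
  - by have /and3P[/implyP->] := gP i i.
  - by have /and3P[_ /implyP->] := gP i j.
  - by have /and3P[_ _ /implyP->] := gP i j; rewrite // lt.
apply/and3P; split; apply/implyP.
- by move/eqP->; rewrite g1.
- by move/g0->.
- by case/andP=> lt /(gA _ _ lt)->.
Qed.

Lemma UT_graphS A A' : A \subset A' -> UT_graph F A' \subset UT_graph F A.
Proof.
move/subsetP=> sA; apply/subsetP => g /UT_graphP[g1 g0 gA]; apply/UT_graphP.
by split=> // i j lt /sA; apply: gA.
Qed.

Lemma UT_graphJ A g u : indifference A -> g \in UT_graph F A -> u \in UT F n ->
  (g ^ u)%g \in UT_graph F A.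
Proof.
move=> [_ indA] gA uU.
have gU : g \in UT F n by apply: subsetP gA; apply/UT_graphS/sub0set.
have /UT_graphP[gu1 gu0 _] : (g ^ u)%g \in UT F n by rewrite groupJ.
apply/UT_graphP; split=> // i j lt_ij Aij.
have /UT_graphP[u1 u0 _] := uU.
have : (u^-1)%g \in UT F n by rewrite groupV.
set v := (u^-1)%g => /UT_graphP[v1 v0 _].
have /UT_graphP[g1 g0 gA0] := gA.
have vgu h : (v * h * u)%g i j = \sum_l \sum_k v i k * h k l * u l j.
  rewrite GL_mulE; apply: eq_bigr => l _.
  by rewrite GL_mulE mulr_suml.
(* Subtracting the identity removes the diagonal of [g]. A remaining nonzero term would use an entry
   [(k, l)] of [g] with [i <= k < l <= j], and indifference puts that pair in [A]. *)
rewrite conjgE -/v; transitivity ((v * g * u)%g i j - (v * 1 * u)%g i j).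
  by rewrite mulg1 mulVg GL_oneE -val_eqE /= (ltn_eqF lt_ij) subr0 mulmxA.
rewrite !vgu -sumrB big1 // => l _; rewrite -sumrB big1 // => k _.
rewrite -mulrBl -mulrBr GL_oneE.
have [lt_ki|le_ik] := ltnP k i; first by rewrite v0 ?mul0r.
have [lt_jl|le_lj] := ltnP j l; first by rewrite u0 ?mulr0.
have [lt_lk|lt_kl|/val_inj->] := ltngtP l k.
- by rewrite g0 // -val_eqE /= (gtn_eqF lt_lk) subrr mulr0 mul0r.
- rewrite gA0 //; first by rewrite -val_eqE /= (ltn_eqF lt_kl) subrr mulr0 mul0r.
  exact: indA Aij.
- by rewrite g1 eqxx subrr mulr0 mul0r.
Qed.

Definition upper : {set 'I_n * 'I_n} := [set e : 'I_n * 'I_n | (e.1 < e.2)%N].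

Lemma unitriangular_unit (f : 'I_n -> 'I_n -> F) :
  \matrix_(i, j) (if i == j then 1 else if (i < j)%N then f i j else 0) \in unitmx.
Proof.
rewrite -unitmx_tr unitmxE det_trig ?unitr1 //.
  by rewrite big1 ?unitr1 // => i _; rewrite !mxE eqxx.
apply/is_trig_mxP => i j lt_ij; rewrite !mxE -val_eqE /= (gtn_eqF lt_ij).
by rewrite ltnNge ltnW.
Qed.

(** The entries above the diagonal and outside [A] are free. The set [A] is arbitrary because the
    count is applied to [A :|: inversions b], which may fail to be an indifference graph. *)
Lemma card_UT_graph A : #|UT_graph F A| = (#|F| ^ #|upper :\: A|)%N.
Proof.
pose mk (f : {ffun 'I_n * 'I_n -> F}) : GL F n :=
  MkGL (unitriangular_unit (fun i j => if (i, j) \in A then 0 else f (i, j))).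
rewrite -(card_pffun_on 0 (mem (upper :\: A)) (mem predT)).
rewrite -(card_in_imset (f := mk) (D := pffun_on 0 (upper :\: A) predT)) => [|f f'].
  apply: eq_card => g; apply/UT_graphP/imsetP => [[g1 g0 gA]|[f _ ->]].
    exists [ffun e => if e \in upper :\: A then g e.1 e.2 else 0].
      apply/pffun_onP; split=> //; apply/supportP => e /negbTE eD.
      by rewrite ffunE eD.
    apply: val_inj; apply/matrixP => i j; rewrite mxE ffunE !inE /=.
    have [->|nij] := eqVneq i j; first by rewrite g1.
    case: ltnP => [lt_ij|le_ji].
      by have [Aij|nA] := boolP ((i, j) \in A); first by rewrite gA.
    by rewrite g0 // ltn_neqAle le_ji andbT eq_sym.
  split=> [i|i j lt|i j lt Aij]; rewrite /= mxE ?eqxx //.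
    by rewrite -val_eqE /= (gtn_eqF lt) ltnNge ltnW.
  by rewrite -val_eqE /= (ltn_eqF lt) lt Aij.
move=> /pffun_onP[/supportP f0 _] /pffun_onP[/supportP f0' _] /(congr1 val) /= e.
apply/ffunP => -[i j]; have [eD|nD] := boolP ((i, j) \in upper :\: A); last first.
  by rewrite f0 // f0'.
move: eD; rewrite !inE /= => /andP[nA lt].
have := congr1 (fun M : 'M_n => M i j) e.
by rewrite !mxE -val_eqE /= (ltn_eqF lt) lt (negbTE nA).
Qed.

Definition inversions b : {set 'I_n * 'I_n} :=
  [set e : 'I_n * 'I_n | (e.1 < e.2)%N && (b e.2 < b e.1)%N].

Lemma UT_graph_parabolic A b :
  UT_graph F A :&: parabolic F b = UT_graph F (A :|: inversions b).
Proof.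
apply/setP => g; rewrite inE; apply/andP/UT_graphP.
  case=> /UT_graphP[g1 g0 gA] /parabolicP gb; split=> // i j lt.
  by rewrite !inE lt /= => /orP[/gA->|/gb].
case=> g1 g0 gA; split; last first.
  apply/parabolicP => i j lt; have [lt_ij|lt_ji|e] := ltngtP i j.
  - by rewrite gA // !inE lt_ij lt orbT.
  - exact: g0.
  - by rewrite (val_inj e) ltnn in lt.
by apply/UT_graphP; split=> // i j lt Aij; rewrite gA // inE Aij.
Qed.

(** A nonzero term in the determinant of [h^-1] yields [t]; block triangularity of [h^-1] and [k]
    gives inequalities that [perm_leq_eq] sharpens. Conversely permutation matrices suffice, so
    these are double cosets of Young subgroups. *)
Lemma parabolic_dcosetP b1 b2 s s' :
  reflect (exists t : 'S_n, (forall i, b1 (t i) = b1 i)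
                            /\ forall i, b2 (s i) = b2 (s' (t i)))
    (same_dcoset (parabolic_group F b1) (parabolic_group F b2) (@GLperm F n) s s').
Proof.
apply: (iffP exists_inP) => [[h Qh /exists_inP[k Qk /eqP e]]|[t [tb1 tb2]]].
  have {}Qh : (h^-1)%g \in parabolic F b1 by rewrite groupV.
  have rE i l : (h^-1)%g i l = k (s i) (s' l).
    by rewrite -GLperm_mull -(GLperm_mulr s') -e !mulgA mulVg mul1g.
  have [t rt] : exists t : 'S_n, forall i, (h^-1)%g i (t i) != 0.
    have : \det ((h^-1)%g : 'M_n) != 0.
      by rewrite -unitfE -unitmxE GLmx_unit.
    have [/existsP[t /forallP tP] _|/existsPn nex] :=
      boolP [exists t : 'S_n, [forall i, (h^-1)%g i (t i) != 0]]; first by exists t.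
    rewrite /determinant big1 ?eqxx // => t _.
    have /forallPn[i /negPn/eqP e0] := nex t.
    by rewrite (bigD1 i) //= e0 mul0r mulr0.
  exists t; split.
    have le i : (b1 ((1 : 'S_n)%g i) <= b1 (t i))%N.
      by rewrite perm1; apply: parabolic_neq0 Qh (rt i).
    by move=> i; rewrite -(perm_leq_eq le) perm1.
  have le i : (b2 (s i) <= b2 ((t * s')%g i))%N.
    by rewrite permM; apply: parabolic_neq0 Qk _; rewrite -rE.
  by move=> i; rewrite (perm_leq_eq le) permM.
have e : (GLperm F t^-1 * GLperm F s * GLperm F (s^-1 * (t * s')) = GLperm F s')%g.
  by rewrite -!GLpermM !mulgA mulgK mulVg mul1g.
exists (GLperm F t^-1%g).
  apply/parabolicP => i j; rewrite GLpermE; case: eqP => // <-.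
  by rewrite -{2}[i](permKV t) tb1 ltnn.
apply/exists_inP; exists (GLperm F (s^-1 * (t * s'))%g); last by rewrite e.
apply/parabolicP => i j; rewrite GLpermE; case: eqP => // <-.
by rewrite !permM -tb2 permKV ltnn.
Qed.

(** Here the diagonal of [h^-1] consists of ones, so the permutation [t] of [parabolic_dcosetP] can
    be the identity: the double cosets correspond to the words [b \o s]. *)
Lemma UT_dcosetE b s s' :
  same_dcoset (UT_group F n) (parabolic_group F b) (@GLperm F n) s s'
  = [forall i, b (s i) == b (s' i)].
Proof.
apply/exists_inP/eqfunP => [[h Uh /exists_inP[k Qk /eqP e]]|eb].
  have {Uh} /UT_graphP[h1 _ _] : (h^-1)%g \in UT F n by rewrite groupV.
  have le i : (b (s i) <= b (s' i))%N.
    apply: parabolic_neq0 Qk _.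
    rewrite -GLperm_mull; have -> : (GLperm F s * k = h^-1 * GLperm F s')%g.
      by rewrite -e !mulgA mulVg mul1g.
    by rewrite GLperm_mulr h1 oner_eq0.
  exact: perm_leq_eq le.
exists 1%g; first exact: group1.
apply/exists_inP; exists (GLperm F (s^-1 * s')%g).
  apply/parabolicP => i j; rewrite GLpermE; case: eqP => // <-.
  by rewrite permM -eb permKV ltnn.
by rewrite mul1g -GLpermM mulKVg.
Qed.

Lemma parabolic_cover b1 b2 x : exists h k s,
  [/\ h \in parabolic F b1, k \in parabolic F b2 & (h * x * k)%g = GLperm F s].
Proof.
apply: (@Bruhat_cover F n b1 b2 (parabolic_group F b1)) => u i0 u1 u2 u3.
apply/parabolicP => i j lt; have [ej|nj] := eqVneq j i0.
  by apply/eqP; apply: contraTT lt; rewrite ej -leqNgt; apply: u3.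
by rewrite u1 //; case: eqP => // e; rewrite e ltnn in lt.
Qed.

Lemma UT_cover b x : exists h k s,
  [/\ h \in UT F n, k \in parabolic F b & (h * x * k)%g = GLperm F s].
Proof.
apply: (@Bruhat_cover F n (@nat_of_ord n) b (UT_group F n)) => u i0 u1 u2 u3.
apply/UT_graphP; split=> [i|i j lt|i j _]; last by rewrite inE.
  by have [->|ni] := eqVneq i i0; [|rewrite u1 ?eqxx].
have [ej|nj] := eqVneq j i0.
  by apply/eqP; apply: contraTT lt; rewrite ej -leqNgt; apply: u3.
by rewrite u1 // -val_eqE /= (gtn_eqF lt).
Qed.

Notation IndP b := ('Ind[[set: GL F n]] (1 : 'CF(parabolic F b))).

(* The scalar products only involve double cosets of the symmetric group, which
   do not see the order of the blocks; so the difference of the two characters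
   is orthogonal to both, hence zero. *)
Lemma Ind_parabolic_eq b b' (v : 'S_n) :
    (forall i j, (b (v i) == b (v j)) = (b' i == b' j)) ->
  IndP b = IndP b'.
Proof.
move=> bb'.
have M b1 : '[IndP b1, IndP b] = '[IndP b1, IndP b'].
  rewrite !(@cfdot_Ind_cfun1_dcosets _ _ _ _ (@GLperm F n)); try exact: parabolic_cover.
  (* Since [(s * v) i] is [v (s i)], right multiplication by [v] carries the classes for [b'] to
     those for [b]. *)
  rewrite (reindex_inj (mulIg v)); apply: eq_bigr => s _; congr (_%:R^-1).
  rewrite -[RHS](card_imset _ (mulIg v)); apply: eq_card => s''.
  rewrite -[s''](mulgKV v) (mem_imset _ _ (@mulIg _ v)) !inE.
  by apply/parabolic_dcosetP/parabolic_dcosetP => -[t [tb1 tb]]; exists t;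
    split=> // i; apply/eqP; move/eqP: (tb i); rewrite !permM bb'.
apply/eqP; rewrite -subr_eq0 -cfnorm_eq0 cfdotBl !cfdotBr.
by rewrite !M !subrr.
Qed.

End Parabolics.

Lemma same_fibers_perm n (T : finType) (f f' : 'I_n -> T) :
    (forall v, #|[set i | f i == v]| = #|[set i | f' i == v]|) ->
  exists s : 'S_n, forall i, f' i = f (s i).
Proof.
move=> fib; have cnt (h : 'I_n -> T) (v : T) :
    count_mem v (map h (enum 'I_n)) = #|[set i | h i == v]|.
  by rewrite count_map cardsE cardE size_filter enumT; apply: eq_count.
have /tuple_permP[s e] : perm_eq (map f' (enum 'I_n)) [tuple f i | i < n].
  by apply/allP => v _ /=; rewrite !cnt fib.
exists s => i; have := congr1 (fun t => nth (f' i) t i) e.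
rewrite (nth_map i) ?size_enum_ord // nth_ord_enum => ->.
by rewrite -tnth_nth !tnth_mktuple.
Qed.

(** * Pairing of indifference graph characters with flag characters *)

Section Pseudosupercharacters.
Variables (F : finFieldType) (n : nat).
Implicit Types (b : 'I_n -> nat) (s t : 'S_n) (g : GL F n) (A : {set 'I_n * 'I_n}).

Notation IndP b := ('Ind[[set: GL F n]] (1 : 'CF(parabolic F b))).

Lemma cardF_neq0 : #|F|%:R != 0 :> algC.
Proof. by rewrite pnatr_eq0 -lt0n; apply/card_gt0P; exists 0. Qed.

(** Inclusion-exclusion on the exponents of [#|F|], written as a product to avoid division. *)
Lemma card_UT_graph_sub A b : A \subset upper n ->
  (#|UT_graph F A| * #|UT_graph F (inversions b)| * #|F| ^ #|A :&: inversions b|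
   = #|UT F n| * #|UT_graph F (A :|: inversions b)|)%N.
Proof.
move=> sAU; have sIU : inversions b \subset upper n.
  by apply/subsetP => e; rewrite !inE => /andP[].
rewrite !card_UT_graph -!expnD setD0; congr (_ ^ _)%N.
rewrite !cardsDS ?subUset ?sAU // cardsU.
have leA := subset_leq_card sAU; have leI := subset_leq_card sIU.
have : (#|A :|: inversions b| <= #|upper n|)%N by rewrite subset_leq_card // subUset sAU.
have : (#|A :&: inversions b| <= #|A|)%N by rewrite subset_leq_card ?subsetIl.
rewrite cardsU; lia.
Qed.

Lemma cfdot_Ind_UT_graph A b : indifference A ->
  '['Ind[[set: GL F n]] (1 : 'CF(<<UT_graph F A>>)), IndP b]
  = \sum_(s : 'S_n) #|[set t : 'S_n | [forall i, b (s i) == b (t i)]]|%:R^-1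
           * #|F|%:R ^+ #|A :&: inversions (b \o s)|.
Proof.
move=> indA; rewrite cfdot_Ind_cfun1 /=.
have UAE : <<UT_graph F A>> = UT_graph F A.
  exact: (genGid (Group (UT_graph_group_set F indA))).
have sAU : A \subset upper n.
  by apply/subsetP => -[i j] /(proj1 indA); rewrite inE.
(* The sum is organised by double cosets of [UT] instead of those of [UT_graph A]. The invariance of
   [phi] under left multiplication by [UT] is the normality lemma [UT_graphJ]. *)
pose phi (x : GL F n) : algC := #|[set h in UT_graph F A | (h ^ x)%g \in parabolic F b]|%:R.
rewrite UAE (eq_bigr phi) //.
rewrite (@sum_dcosets _ _ _ _ (@GLperm F n) (UT_cover b)) => [|x u k Uu Kk]; last first.
  rewrite /phi; congr _%:R; rewrite -(card_imset _ (conjg_inj u)).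
  apply: eq_card => h; rewrite -[h](conjgKV u) (mem_imset _ _ (@conjg_inj _ u)).
  rewrite conjgKV; apply/setIdP/setIdP; rewrite !conjgM (groupJr _ Kk) !conjgKV.
    by case=> hA; split=> //; rewrite -[h](conjgKV u) UT_graphJ.
  by case=> hA; split=> //; rewrite UT_graphJ // groupV.
rewrite mulrA !mulr_sumr; apply: eq_bigr => s _.
have -> : [set t | same_dcoset (UT_group F n) (parabolic_group F b) (@GLperm F n) s t]
    = [set t : 'S_n | [forall i, b (s i) == b (t i)]].
  by apply/setP => t; rewrite !inE UT_dcosetE.
(* Used for [B := A], which gives [phi (GLperm s)], and for [B := set0], which gives the stabilizer
   in [UT]. *)
have phi_w B : [set h in UT_graph F B | (h ^ GLperm F s)%g \in parabolic F b]
    = UT_graph F (B :|: inversions (b \o s)).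
  rewrite -UT_graph_parabolic; apply/setP => h.
  by apply/setIdP/setIP; rewrite parabolic_conj.
rewrite /phi !phi_w set0U.
set q := #|F|%:R; set N := #|[set t : 'S_n | _]|%:R.
have e := congr1 (fun k => k%:R : algC) (card_UT_graph_sub (b \o s) sAU).
rewrite !natrM natrX in e.
have nz (B : {set 'I_n * 'I_n}) : #|UT_graph F B|%:R != 0 :> algC.
  by rewrite card_UT_graph natrX expf_neq0 // cardF_neq0.
have nzQ : #|parabolic F b|%:R != 0 :> algC := neq0CG _.
have nzN : N != 0.
  rewrite pnatr_eq0 -lt0n card_gt0; apply/set0Pn; exists s.
  by rewrite inE; apply/forallP => i.
apply: (mulfI (nz A)); apply: (mulfI (nz (inversions (b \o s)))).
apply: (mulfI nzN); apply: (mulfI nzQ).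
rewrite -/q in e *.
transitivity (#|parabolic F b|%:R
    * (#|UT F n|%:R * #|UT_graph F (A :|: inversions (b \o s))|%:R) : algC).
  by field; rewrite nzQ nzN !nz.
by rewrite -e; field.
Qed.

End Pseudosupercharacters.

(** * Pseudosupercharacters *)

(** The abscissa never decreases along the path, and a step other than [stepS] raises it. *)
Lemma step_at_abscissa_inj (p : seq step) k k' :
    (k < size p)%N -> (k' < size p)%N ->
    nth stepE p k != stepS -> nth stepE p k' != stepS ->
    abscissa (take k p) = abscissa (take k' p) -> k = k'.
Proof.
wlog lt : k k' / (k < k')%N => [hw|lt_k _ nS _ e].
  move=> *; have [lt|lt|//] := ltngtP k k'; first exact: hw.
  by apply/esym/hw.
have := count_take_mono (predC1 stepS) p lt.
rewrite (take_nth stepE lt_k) -cats1 count_cat /= nS addn0 addn1.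
by rewrite -[count _ _]/(abscissa _) -[X in (_ < X)%N]/(abscissa _) e ltnn.
Qed.

(** Only one step crosses the column of the square. If it is the [D] step starting at depth [e.1],
    it ends one unit deeper, too low for [Area]. *)
Lemma Area_Diag_disjoint n (p : seq step) : [disjoint Area n p & Diag n p].
Proof.
apply/pred0P => e /=; apply/negP => /andP[].
rewrite !inE => /andP[_ /existsP[k /and3P[nS /eqP ak dk]]].
case/andP=> _ /existsP[k' /and3P[/eqP isD /eqP ak' /eqP dk']].
have ekk' : k = k' :> nat.
  by apply: step_at_abscissa_inj nS _ _; rewrite ?isD ?ak ?ak'.
move: dk; rewrite ekk' (take_nth stepE (ltn_ord k')) isD /depth -cats1 count_cat /=.
by rewrite addn1 -[count _ _]/(depth _) dk' ltnn.
Qed.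

Lemma sum_powerset_sign (R : comRingType) (I : finType) (D : {set I}) (a : I -> R) :
  \sum_(S in powerset D) (-1) ^+ #|D :\: S| * \prod_(e in S) a e
  = \prod_(e in D) (a e - 1).
Proof.
(* Outside [D] the factor is 0 + 1, so the expansion over all subsets keeps exactly those contained
   in [D]. *)
pose f e := if e \in D then a e else 0; pose g e : R := if e \in D then -1 else 1.
have -> : \prod_(e in D) (a e - 1) = \prod_e (f e + g e).
  rewrite big_mkcond; apply: eq_bigr => e _; rewrite /f /g.
  by case: ifP; rewrite ?add0r.
rewrite bigA_distr big_mkcond /=; apply: eq_big => // S _.
rewrite powersetE; case: ifP => [/subsetP sSD|/negbT/subsetPn[e eS eD]]; last first.
  by rewrite (bigD1 e) //= eS /f (negbTE eD) mul0r.
rewrite [RHS](bigID (mem S)) /= mulrC; congr (_ * _).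
  by apply: eq_bigr => e eS; rewrite eS /f sSD.
rewrite -prodr_const [RHS]big_mkcond [LHS]big_mkcond; apply: eq_bigr => e _.
by rewrite inE /g; case: (e \in S).
Qed.

(** * Pairing of the pseudosupercharacter with flag characters *)

Section PsiPairing.
Variables (F : finFieldType) (n : nat) (p : seq step).
Notation q := (#|F|%:R : algC).

(** Each [e] in [Diag] contributes a factor [q - 1] if it lies in [I] and [1 - 1 = 0] otherwise;
    this is where strictness along [Diag] comes from. *)
Lemma sum_weights (I : {set 'I_n * 'I_n}) :
  \sum_(S in powerset (Diag n p))
     (-1) ^+ #|Diag n p :\: S| * q ^+ #|(Area n p :|: S) :&: I|
  = (q - 1) ^+ #|Diag n p| * (Diag n p \subset I)%:R * q ^+ #|Area n p :&: I|.
Proof.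
transitivity (q ^+ #|Area n p :&: I| * \sum_(S in powerset (Diag n p))
    (-1) ^+ #|Diag n p :\: S| * \prod_(e in S) q ^+ (e \in I)).
  rewrite mulr_sumr; apply: eq_bigr => S; rewrite powersetE => sSD.
  rewrite mulrCA; congr (_ * _); rewrite prodrXr -exprD; congr (_ ^+ _).
  rewrite setIUl cardsU -setIIl.
  have -> : Area n p :&: S = set0.
    apply/eqP; rewrite setI_eq0; apply: disjointWr sSD _.
    exact: Area_Diag_disjoint.
  rewrite set0I cards0 subn0; congr (_ + _)%N.
  rewrite -sum1_card big_mkcond [RHS]big_mkcond; apply: eq_bigr => e _.
  by rewrite inE; case: (e \in S).
rewrite sum_powerset_sign mulrC; congr (_ * _).
have [/subsetP sDI|/subsetPn[e eD eI]] := boolP (Diag n p \subset I).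
  rewrite mulr1 -prodr_const; apply: eq_bigr => e eD.
  by rewrite sDI.
by rewrite mulr0 (bigD1 e) //= (negbTE eI) expr0 subrr mul0r.
Qed.

Lemma cfdot_Ind_psi_parabolic (b : 'I_n -> nat) :
  '['Ind[[set: GL F n]] (psi F n p), 'Ind[[set: GL F n]] (1 : 'CF(parabolic F b))]
  = (q - 1) ^+ #|Diag n p| *
    \sum_(s : 'S_n) #|[set t : 'S_n | [forall i, b (s i) == b (t i)]]|%:R^-1
      * ((Diag n p \subset inversions (b \o s))%:R
         * q ^+ #|Area n p :&: inversions (b \o s)|).
Proof.
rewrite /psi linear_sum cfdot_suml.
transitivity (\sum_(S in powerset (Diag n p)) \sum_(s : 'S_n)
   #|[set t : 'S_n | [forall i, b (s i) == b (t i)]]|%:R^-1 *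
   ((-1) ^+ #|Diag n p :\: S| * q ^+ #|(Area n p :|: S) :&: inversions (b \o s)|)).
  apply: eq_bigr => S; rewrite powersetE => sSD.
  rewrite linearZ /= cfdotZl /chibar cfIndInd ?subsetT //; last first.
    by rewrite gen_subG; apply/UT_graphS/sub0set.
  rewrite cfdot_Ind_UT_graph; last exact: area_diag_indifference.
  by rewrite mulr_sumr; apply: eq_bigr => s _; rewrite mulrCA.
rewrite exchange_big /= mulr_sumr; apply: eq_bigr => s _.
rewrite -mulr_sumr sum_weights; ring.
Qed.

(** Each rearrangement of [k0] comes from as many permutations as its weight divides by. *)
Lemma sum_rearrangements m (k0 : {ffun 'I_n -> 'I_m}) (G : {ffun 'I_n -> 'I_m} -> algC) :
  \sum_(s : 'S_n) #|[set t : 'S_n | [forall i, k0 (s i) == k0 (t i)]]|%:R^-1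
     * G [ffun i => k0 (s i)]
  = \sum_(k : {ffun 'I_n -> 'I_m} |
          [forall v, #|[set i | k i == v]| == #|[set i | k0 i == v]|]) G k.
Proof.
rewrite (partition_big (fun s : 'S_n => [ffun i => k0 (s i)])
  (fun k => [forall v, #|[set i | k i == v]| == #|[set i | k0 i == v]|])) /=; last first.
  move=> s _; apply/forallP => v; rewrite -(card_imset [set i | _] (@perm_inj _ s)).
  apply/eqP/eq_card => i; rewrite -[i](permKV s) (mem_imset _ _ (@perm_inj _ s)).
  by rewrite !inE ffunE.
apply: eq_bigr => k /forallP fib.
have [s0 s0P] : exists s : 'S_n, forall i, k i = k0 (s i).
  by apply: same_fibers_perm => v; rewrite (eqP (fib v)).
rewrite (eq_bigr (fun=> #|[set t : 'S_n | [forall i, k i == k0 (t i)]]|%:R^-1 * G k)).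
  rewrite (eq_bigl (mem [set t : 'S_n | [forall i, k i == k0 (t i)]])) => [|t].
    rewrite sumr_const -[LHS]mulr_natl mulrA mulfV ?mul1r // pnatr_eq0 -lt0n.
    rewrite card_gt0; apply/set0Pn; exists s0.
    by rewrite inE; apply/eqfunP => i; rewrite s0P.
  rewrite [RHS]inE; apply/eqP/eqfunP => [<- i|e]; first by rewrite ffunE.
  by apply/ffunP => i; rewrite ffunE e.
move=> s /eqP <-; congr (_%:R^-1 * _); apply: eq_card => t; rewrite !inE.
by apply: eq_forallb => i; rewrite ffunE.
Qed.

(** The block index [m - k0 i] reverses the order of the letters, so that inversions of the block
    word become the ascents of the coloring. *)
Lemma cfdot_Ind_psi m (k0 : {ffun 'I_n -> 'I_m}) :
  '['Ind[[set: GL F n]] (psi F n p),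
    'Ind[[set: GL F n]] (1 : 'CF(parabolic F (fun i => m - k0 i)%N))]
  = (q - 1) ^+ #|Diag n p| *
    \sum_(k : {ffun 'I_n -> 'I_m} |
          [forall v, #|[set i | k i == v]| == #|[set i | k0 i == v]|]
          && [forall e in Diag n p, (k e.1 < k e.2)%N])
      q ^+ asc p k.
Proof.
rewrite cfdot_Ind_psi_parabolic; congr (_ * _).
have sub_inj (i j : 'I_m) : (m - i == m - j)%N = (i == j).
  apply/eqP/eqP => [e|->//]; apply: val_inj => /=.
  by have := ltn_ord i; have := ltn_ord j; lia.
have sub_lt (i j : 'I_m) : (m - j < m - i)%N = (i < j)%N.
  by have := ltn_ord i; have := ltn_ord j; lia.
rewrite big_mkcondr -sum_rearrangements; apply: eq_bigr => s _.
congr (_%:R^-1 * _).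
  by apply: eq_card => t; rewrite !inE; under eq_forallb do rewrite sub_inj.
set k := [ffun i => _].
have inv e : (e \in inversions ((fun i => m - k0 i)%N \o s))
    = (e.1 < e.2)%N && (k e.1 < k e.2)%N.
  by rewrite inE /= sub_lt !ffunE.
have -> : (Diag n p \subset inversions ((fun i => m - k0 i)%N \o s))
    = [forall e in Diag n p, (k e.1 < k e.2)%N].
  apply/subsetP/forall_inP => H e eD; have := H e eD; rewrite inv; first by case/andP.
  by move->; move: eD; rewrite inE => /andP[->].
case: ifP => _; last by rewrite mul0r.
rewrite mul1r; congr (_ ^+ _); apply: eq_card => e.
rewrite in_setI inv [RHS]in_set; have [|//] := boolP (e \in Area n p).
by rewrite inE => /andP[->].
Qed.

End PsiPairing.

(** * Semistandard tableaux *)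

Lemma card_ord_lt n k : (k <= n)%N -> #|[set i : 'I_n | (i < k)%N]| = k.
Proof.
move=> le_kn; rewrite -sum1_card (eq_bigl (fun i : 'I_n => (i < k)%N)) => [|i].
  by rewrite -(big_ord_widen n (fun=> 1%N)) // sum1_card card_ord.
by rewrite inE.
Qed.

(** A down-closed set is an initial segment, hence determined by its size. This serves conjugate
    partitions, rows of tableaux and blocks alike. *)
Lemma mem_down_closed n (D : {set 'I_n}) :
    (forall i j : 'I_n, (i < j)%N -> j \in D -> i \in D) ->
  forall j, (j \in D) = (j < #|D|)%N.
Proof.
move=> down j; have [jD|jD] := boolP (j \in D); apply/esym.
  rewrite -(card_ord_lt (ltn_ord j)) subset_leq_card //; apply/subsetP => i.
  rewrite inE ltnS leq_eqVlt => /orP[/eqP/val_inj->//|lt]; exact: down jD.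
apply/negbTE; rewrite -leqNgt -[X in (_ <= X)%N](card_ord_lt (ltnW (ltn_ord j))).
apply: subset_leq_card; apply/subsetP => i iD; rewrite inE ltnNge.
apply: contra jD; rewrite leq_eqVlt => /orP[/eqP/val_inj->//|lt]; exact: down iD.
Qed.

Lemma intpart_noninc n (la : intpart n) (i j : 'I_n) : (i <= j)%N -> (la j <= la i)%N.
Proof.
by have /andP[/'forall_forallP mono _] := intpartP la; apply/implyP/mono.
Qed.

Lemma intpart_sum n (la : intpart n) : (\sum_i la i)%N = n.
Proof. by have /andP[_ /eqP] := intpartP la. Qed.

Lemma intpart_le n (la : intpart n) i : (la i <= n)%N.
Proof. by rewrite -ltnS. Qed.

Lemma conjpartE n (la : intpart n) (j : 'I_n) :
  conjpart la j = #|[set i : 'I_n | (j < la i)%N]| :> nat.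
Proof. exact: conjpart_funE. Qed.

Lemma conjpartK n (la : intpart n) : conjpart (conjpart la) = la.
Proof.
apply: val_inj; apply/ffunP => i; apply: val_inj.
rewrite [LHS]conjpartE -[RHS](card_ord_lt (intpart_le la i)).
congr #|pred_of_set _|; apply/setP => j; rewrite !inE conjpartE.
rewrite -mem_down_closed ?inE // => k l lt_kl; rewrite !inE => lt.
by rewrite (leq_trans lt) // intpart_noninc // ltnW.
Qed.

Section Tableaux.
Variables (n : nat) (la : intpart n).
Implicit Type c d : cell la.

Notation row c := ((val c).1).
Notation col c := ((val c).2).

Lemma cell_col_lt c : (col c < la (row c))%N.
Proof. exact: (valP c). Qed.

Lemma cell_inj c d : row c = row d -> col c = col d -> c = d.
Proof.
move=> e1 e2; apply: val_inj; rewrite (surjective_pairing (val c)) e1 e2.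
by rewrite -surjective_pairing.
Qed.

Lemma cell_exists (r : 'I_n) y : (y < la r)%N ->
  exists2 c : cell la, row c = r & col c = y :> nat.
Proof.
move=> lt; have lt_yn : (y < n)%N by apply: leq_trans lt (intpart_le _ _).
by exists (exist (fun e : 'I_n * 'I_n => (e.2 < la e.1)%N) (r, Ordinal lt_yn) lt).
Qed.

Lemma ssytP m (T : {ffun cell la -> 'I_m}) :
  reflect ((forall c d : cell la, row c = row d -> (col c < col d)%N -> (T c <= T d)%N)
           /\ (forall c d : cell la, col c = col d -> (row c < row d)%N -> (T c < T d)%N))
          (ssyt T).
Proof.
apply: (iffP andP) => -[h1 h2]; split.
- move=> c d e lt; move/'forall_forallP/(_ c d)/implyP: h1; apply.
  by rewrite e eqxx.
- move=> c d e lt; move/'forall_forallP/(_ c d)/implyP: h2; apply.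
  by rewrite e eqxx.
- apply/'forall_forallP => c d; apply/implyP => /andP[/eqP e lt]; exact: h1.
- apply/'forall_forallP => c d; apply/implyP => /andP[/eqP e lt]; exact: h2.
Qed.

Lemma card_row (r : 'I_n) y : (y <= la r)%N ->
  #|[set c : cell la | (row c == r) && (col c < y)%N]| = y.
Proof.
move=> le; rewrite -[RHS](card_ord_lt (leq_trans le (intpart_le _ _))).
rewrite -(card_in_imset (f := fun c : cell la => col c)) => [|c d].
  apply: eq_card => j; rewrite [RHS]inE; apply/imsetP/idP => [[c /[!inE] /andP[_ ?] ->] //|lt].
  have [c e1 e2] := cell_exists (leq_trans lt le).
  by exists c; [rewrite inE e1 eqxx e2|apply: val_inj].
by rewrite !inE => /andP[/eqP e1 _] /andP[/eqP e2 _] e; apply: cell_inj; rewrite // e1.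
Qed.

Lemma card_cells : #|{: cell la}| = n.
Proof.
rewrite -[RHS](intpart_sum la) -sum1_card.
rewrite (partition_big (fun c : cell la => row c) xpredT) //=.
apply: eq_bigr => r _; rewrite -[RHS](card_row (leqnn _)) -sum1_card; apply: eq_bigl => c.
by rewrite inE; case: eqP => //= <-; rewrite cell_col_lt.
Qed.

(** * Tableaux as Gelfand-Tsetlin patterns *)

Section Counts.
Variables (m : nat) (T : {ffun cell la -> 'I_m}).

(** For a semistandard [T] this is the length of row [r] in the shape formed by the entries below
    [x], an entry of the Gelfand-Tsetlin pattern. Rows are natural numbers, empty from [n] on, so
    that [r.+1] always makes sense. *)
Definition row_count (x r : nat) : nat :=
  #|[set c : cell la | (row c == r :> nat) && (T c < x)%N]|.

Lemma row_count_out x r : (n <= r)%N -> row_count x r = 0%N.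
Proof.
move=> le; apply/eqP; rewrite cards_eq0; apply/eqP/setP => c; rewrite !inE.
by have [e|//] := eqP; have := ltn_ord (row c); rewrite e ltnNge le.
Qed.

Lemma row_count_mono x r : (row_count x r <= row_count x.+1 r)%N.
Proof.
apply: subset_leq_card; apply/subsetP => c; rewrite !inE => /andP[-> lt].
exact: ltnW.
Qed.

Lemma row_count_le x (r : 'I_n) : (row_count x r <= la r)%N.
Proof.
rewrite -[X in (_ <= X)%N](card_row (leqnn _)); apply: subset_leq_card.
apply/subsetP => c; rewrite !inE => /andP[/eqP/val_inj e _].
by rewrite e eqxx -e cell_col_lt.
Qed.

Lemma sum_row_count x : (\sum_(r < n) row_count x r)%N = #|[set c : cell la | (T c < x)%N]|.
Proof.
rewrite -sum1_card (partition_big (fun c : cell la => row c) xpredT) //=.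
apply: eq_bigr => r _; rewrite /row_count -sum1_card; apply: eq_bigl => c.
by rewrite !inE andbC.
Qed.

Lemma row_countE N (r : 'I_n) x : (N <= la r)%N ->
  (forall c, row c = r -> (T c < x)%N = (col c < N)%N) -> row_count x r = N.
Proof.
move=> le h; rewrite -[RHS](card_row le); apply: eq_card => c; rewrite !inE.
by have [/val_inj e|ne] := eqP; [rewrite e eqxx h|case: eqP => // e; case: ne; rewrite e].
Qed.

Hypothesis Tss : ssyt T.

Lemma lt_row_count c x : (T c < x)%N = (col c < row_count x (row c))%N.
Proof.
have [Trow _] := ssytP _ Tss.
pose D := [set col d | d in [set d : cell la | (row d == row c :> nat) && (T d < x)%N]].
have -> : row_count x (row c) = #|D|.
  rewrite card_in_imset // => d d'; rewrite !inE => /andP[/eqP/val_inj e1 _].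
  by move=> /andP[/eqP/val_inj e2 _] e; apply: cell_inj; rewrite // e1.
rewrite -mem_down_closed => [|i j lt_ij /imsetP[d /[!inE] /andP[/eqP/val_inj e lt] ej]].
  apply/idP/imsetP => [lt|[d /[!inE] /andP[/eqP/val_inj e lt] ec]].
    by exists c => //; rewrite inE eqxx.
  by rewrite (cell_inj (esym e) ec).
have lti : (i < la (row d))%N by rewrite (ltn_trans lt_ij) // ej cell_col_lt.
have [d' er ec] := cell_exists lti.
apply/imsetP; exists d'; last by apply: val_inj.
rewrite inE er e eqxx /= (leq_ltn_trans _ lt) //; apply: Trow; first by rewrite er.
by rewrite ec -ej.
Qed.

(** Column strictness: above an entry smaller than [x.+1] stands one smaller than [x]. *)
Lemma row_count_interlace x r : (row_count x.+1 r.+1 <= row_count x r)%N.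
Proof.
have [_ Tcol] := ssytP _ Tss.
have [le|lt] := leqP n r.+1; first by rewrite row_count_out.
pose r1 : 'I_n := Ordinal lt; pose r0 : 'I_n := Ordinal (ltnW lt).
rewrite leqNgt; apply/negP => lt_c.
have lt1 : (row_count x r < la r1)%N.
  by apply: leq_trans (row_count_le x.+1 r1).
have lt0 : (row_count x r < la r0)%N.
  by apply: leq_trans lt1 (intpart_noninc _ _); rewrite /= ltnW.
have [c1 er1 ec1] := cell_exists lt1; have [c0 er0 ec0] := cell_exists lt0.
have : (T c1 < x.+1)%N by rewrite lt_row_count ec1 er1.
have : (T c0 < T c1)%N.
  by apply: Tcol; [apply: val_inj; rewrite /= ec0 ec1|rewrite er0 er1 /=].
rewrite ltnS => lt01 le1; have := leq_trans lt01 le1.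
by rewrite lt_row_count ec0 er0 ltnn.
Qed.

End Counts.

Lemma ssyt_interlace m (T : {ffun cell la -> 'I_m}) (N : nat -> nat -> nat) :
    (forall c x, (T c < x)%N = (col c < N x (row c))%N) ->
    (forall x r, N x r <= N x.+1 r)%N ->
    (forall x r, N x.+1 r.+1 <= N x r)%N ->
  ssyt T.
Proof.
move=> TN mono inter; apply/ssytP; split=> c d e lt.
  by rewrite -ltnS TN e (ltn_trans lt) // -TN.
(* Interlacing compares adjacent rows; column strictness needs it for rows at any distance. *)
have le x r k : (N x.+1 (r + k).+1 <= N x r)%N.
  elim: k => [|k IHk]; first by rewrite addn0.
  by rewrite (leq_trans _ IHk) // addnS (leq_trans (inter _ _)) // mono.
rewrite TN e (@leq_trans (N (T d).+1 (row d))) //; first by rewrite -TN.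
by rewrite -(subnKC lt) addSn.
Qed.

Definition ntab m (al : 'I_m -> nat) : nat :=
  #|[set T : {ffun cell la -> 'I_m} |
      ssyt T && [forall i, #|[set c : cell la | T c == i]| == al i]]|.

Lemma content_count m (T : {ffun cell la -> 'I_m}) (v : 'I_m) :
  (#|[set c : cell la | (T c < v)%N]| + #|[set c : cell la | T c == v]|
   = #|[set c : cell la | (T c < v.+1)%N]|)%N.
Proof.
rewrite -cardsUI.
have -> : [set c : cell la | (T c < v)%N] :&: [set c : cell la | T c == v] = set0.
  by apply/setP => c; rewrite !inE; case: eqP => [->|]; rewrite ?ltnn ?andbF.
rewrite cards0 addn0.
by apply: eq_card => c; rewrite !inE ltnS [in RHS]leq_eqVlt orbC -val_eqE.
Qed.

(** * Bender-Knuth involutions *)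

Section BenderKnuth.
Variables (m : nat) (a b : 'I_m).
Hypothesis ab : b = a.+1 :> nat.

(** With levels [a] and [a.+2] of the pattern fixed, interlacing confines level [a.+1] of row [r] to
    the interval from [bk_lower] to [bk_upper]. Row 0 has no row above to bound it. *)
Definition bk_upper (T : {ffun cell la -> 'I_m}) (r : nat) : nat :=
  if r is r'.+1 then minn (row_count T a.+2 r) (row_count T a r')
  else row_count T a.+2 r.

Definition bk_lower (T : {ffun cell la -> 'I_m}) (r : nat) : nat :=
  maxn (row_count T a.+2 r.+1) (row_count T a r).

(** The reflection of level [a.+1] in its interval; by [bk_bounds] the truncated subtraction is
    exact for semistandard [T]. *)
Definition bk_mid (T : {ffun cell la -> 'I_m}) (r : nat) : nat :=
  (bk_lower T r + bk_upper T r - row_count T a.+1 r)%N.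

(* The entries a and b of each row are redistributed so that the end of the
   a's is reflected in the interval that column strictness leaves for it. *)
Definition bk (T : {ffun cell la -> 'I_m}) : {ffun cell la -> 'I_m} :=
  [ffun c => if (T c == a) || (T c == b)
             then if (col c < bk_mid T (row c))%N then a else b else T c].

Definition bk_count T (x r : nat) : nat :=
  if x == a.+1 then bk_mid T r else row_count T x r.

Variable T : {ffun cell la -> 'I_m}.
Hypothesis Tss : ssyt T.

Lemma bk_bounds r :
  [/\ bk_lower T r <= row_count T a.+1 r, row_count T a.+1 r <= bk_upper T r,
      row_count T a r <= bk_lower T r & bk_upper T r <= row_count T a.+2 r]%N.
Proof.
have i1 := row_count_interlace Tss a.+1 r.
have m1 := row_count_mono T a r; have m2 := row_count_mono T a.+1 r.
rewrite /bk_lower /bk_upper; case: r i1 m1 m2 => [|r] i1 m1 m2.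
  by split; rewrite ?geq_max ?i1 ?leq_maxr.
have i2 := row_count_interlace Tss a r.
by split; rewrite ?geq_max ?leq_min ?i1 ?i2 ?m2 ?leq_maxr ?geq_minl.
Qed.

Lemma bk_mid_bounds r : (bk_lower T r <= bk_mid T r <= bk_upper T r)%N.
Proof. by have [? ? ? ?] := bk_bounds r; rewrite /bk_mid; lia. Qed.

Lemma bk_lt c x : (bk T c < x)%N = (col c < bk_count T x (row c))%N.
Proof.
have [] := bk_bounds (row c); have := bk_mid_bounds (row c).
have := lt_row_count Tss c a; have := lt_row_count Tss c a.+2.
have := lt_row_count Tss c x.
rewrite ffunE /bk_count -!val_eqE /= ab => hx ha h2 bounds l1 l2 l3 l4.
case: (x =P a.+1) => [->|nx]; last rewrite -hx.
  case: ifP => [_|nab].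
    case: ifP => lt; rewrite ?ab; lia.
  have [lt|le] := ltnP (T c) a; lia.
case: ifP => [eab|//]; case: ifP => lt; rewrite ?ab; lia.
Qed.

Lemma bk_ssyt : ssyt (bk T).
Proof.
apply: (ssyt_interlace bk_lt) => x r; rewrite /bk_count.
  have [? ? ? ?] := bk_bounds r; have := bk_mid_bounds r.
  have := row_count_mono T x r.
  case: (x =P a.+1) => [->|nx]; first by rewrite gtn_eqF // => _; lia.
  by case: (x.+1 =P a.+1) => [[->]|] //; lia.
have [? ? ? ?] := bk_bounds r; have := bk_mid_bounds r.
have := row_count_interlace Tss x r.
case: (x =P a.+1) => [->|nx].
  rewrite gtn_eqF // => _; rewrite /bk_lower; lia.
case: (x.+1 =P a.+1) => [[->]|] //.
by have /andP[_ h] := bk_mid_bounds r.+1; rewrite (leq_trans h) // geq_minr.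
Qed.

Lemma row_count_bk x r : row_count (bk T) x r = bk_count T x r.
Proof.
have [le|lt] := leqP n r.
  rewrite row_count_out // /bk_count; case: ifP => _; last by rewrite row_count_out.
  have [] := bk_bounds r; have := bk_mid_bounds r.
  by rewrite (row_count_out T a.+2) //; lia.
apply: (row_countE (r := Ordinal lt)) => [|c e]; last by rewrite bk_lt e.
rewrite /bk_count; case: ifP => _; last exact: (row_count_le T x (Ordinal lt)).
have [] := bk_bounds r; have := bk_mid_bounds r.
by have /= := row_count_le T a.+2 (Ordinal lt); lia.
Qed.

(** The lower bound of a row and the upper bound of the next are the maximum and minimum of the same
    two numbers, so their sum simplifies; [bk_upper T k] is the unpaired bound at the end. *)
Lemma sum_bk_bounds k :
  (\sum_(r < k) (bk_lower T r + bk_upper T r) + bk_upper T k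
   = \sum_(r < k) (row_count T a r + row_count T a.+2 r) + row_count T a.+2 k)%N.
Proof.
elim: k => [|k IHk]; first by rewrite !big_ord0.
rewrite !big_ord_recr /= /bk_lower; move: IHk; set S1 := (\sum_(_ < _) _)%N.
set S2 := (\sum_(_ < _) _)%N.
have := addn_min_max (row_count T a.+2 k.+1) (row_count T a k).
move: (minn _ _) (maxn _ _) (bk_upper T k); lia.
Qed.

(** At [k = n] the boundary terms vanish. Subtracting the level totals shows that the numbers of
    entries [a] and [b] are exchanged. *)
Lemma sum_bk_mid :
  (\sum_(r < n) bk_mid T r + \sum_(r < n) row_count T a.+1 r
   = \sum_(r < n) row_count T a r + \sum_(r < n) row_count T a.+2 r)%N.
Proof.
have := sum_bk_bounds n; have [] := bk_bounds n.
rewrite (row_count_out T a.+2) // addn0 -!big_split /= => _ _ _.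
rewrite leqn0 => /eqP-> <-; rewrite addn0; apply: eq_bigr => r _.
by rewrite /bk_mid subnK //; have [] := bk_bounds r; lia.
Qed.

Lemma bk_content v :
  #|[set c : cell la | bk T c == v]| = #|[set c : cell la | T c == tperm a b v]|.
Proof.
have cT := content_count T; have cB := content_count (bk T) v.
have := sum_bk_mid; have ca := cT a; have cb := cT b; rewrite ab in cb.
move: cB ca cb; rewrite -!sum_row_count.
have eB x : (\sum_(r < n) row_count (bk T) x r = \sum_(r < n) bk_count T x r)%N.
  by apply: eq_bigr => r _; rewrite row_count_bk.
rewrite !eB /bk_count; case: tpermP => [->|->|na nb].
- rewrite ltn_eqF // eqxx. lia.
- by rewrite ab eqxx gtn_eqF //; lia.
have /negbTE-> : v != a.+1 :> nat by rewrite -ab val_eqE; apply/eqP.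
have /negbTE-> : v.+1 != a.+1 :> nat by rewrite eqSS val_eqE; apply/eqP.
have := cT v; rewrite -!sum_row_count; lia.
Qed.

End BenderKnuth.
End Tableaux.

(** * Symmetry of Kostka numbers in the content *)

Section KostkaSymmetry.
Variables (n : nat) (la : intpart n).

(** The bounds depend only on levels [a] and [a.+2], which [bk] leaves alone, and reflecting twice
    in one interval is the identity. *)
Lemma bkK m (a b : 'I_m) (T : {ffun cell la -> 'I_m}) :
  b = a.+1 :> nat -> ssyt T -> bk a b (bk a b T) = T.
Proof.
move=> ab Tss; have bss := bk_ssyt ab Tss.
have low r : bk_lower a (bk a b T) r = bk_lower a T r.
  by rewrite /bk_lower !(row_count_bk ab Tss) /bk_count gtn_eqF // ltn_eqF.
have upp r : bk_upper a (bk a b T) r = bk_upper a T r.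
  by case: r => [|r]; rewrite /bk_upper !(row_count_bk ab Tss) /bk_count gtn_eqF // ltn_eqF.
have bbE x r : bk_count a (bk a b T) x r = row_count T x r.
  rewrite /bk_count (row_count_bk ab Tss) /bk_count; case: eqP => // ->.
  rewrite {1}/bk_mid low upp (row_count_bk ab Tss) /bk_count eqxx.
  by have [] := bk_bounds a Tss r; rewrite /bk_mid; lia.
apply/ffunP => c; apply: val_inj; apply/eqP.
have lt x : (bk a b (bk a b T) c < x)%N = (T c < x)%N.
  by rewrite (bk_lt ab bss) bbE -(lt_row_count Tss).
by rewrite eqn_leq -[X in X && _]ltnS lt ltnSn -ltnS -lt ltnSn.
Qed.

Lemma eq_ntab m (al be : 'I_m -> nat) : al =1 be -> ntab la al = ntab la be.
Proof.
move=> e; apply: eq_card => T; rewrite !inE; congr (_ && _).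
by apply: eq_forallb => i; rewrite e.
Qed.

Lemma ntab_adjacent m (a b : 'I_m) (al : 'I_m -> nat) :
  b = a.+1 :> nat -> ntab la (al \o tperm a b) = ntab la al.
Proof.
move=> ab.
(* One inequality for all contents is enough, because the transposition is an involution. *)
have le be : (ntab la be <= ntab la (be \o tperm a b))%N.
  rewrite /ntab -(card_in_imset (f := bk a b)) => [|T T']; last first.
    rewrite !inE => /andP[ss _] /andP[ss' _] e.
    by rewrite -(bkK ab ss) e bkK.
  apply: subset_leq_card; apply/subsetP => _ /imsetP[T /[!inE] /andP[ss /forallP ct] ->].
  rewrite bk_ssyt //=; apply/forallP => v.
  by rewrite bk_content // (eqP (ct _)).
apply/eqP; rewrite eqn_leq le andbT (leq_trans (le _)) //.
by rewrite (@eq_ntab _ _ al) // => i /=; rewrite tpermK.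
Qed.

Lemma ntab_perm m (al : 'I_m -> nat) (s : 'S_m) : ntab la (al \o s) = ntab la al.
Proof.
pose P (s : 'S_m) := forall al, ntab la (al \o s) = ntab la al.
have PM s1 s2 : P s1 -> P s2 -> P (s1 * s2)%g.
  move=> P1 P2 al'; rewrite -[RHS]P2 -[RHS]P1.
  by apply: eq_ntab => i; rewrite /= permM.
(* Induction on the distance: with [z] just before [y], conjugating [tperm x z] by the adjacent
   [tperm z y] gives [tperm x y]. *)
have Ptr d (x y : 'I_m) : y = (x + d).+1 :> nat -> P (tperm x y).
  elim: d y => [|d IHd] y e; first by move=> al'; apply: ntab_adjacent; rewrite e addn0.
  have lt_z : ((x + d).+1 < m)%N by rewrite (leq_trans _ (ltn_ord y)) // e addnS.
  pose z : 'I_m := Ordinal lt_z.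
  have Pz : P (tperm z y) by move=> al'; apply: ntab_adjacent; rewrite e addnS.
  have <- : (tperm x z ^ tperm z y)%g = tperm x y.
    rewrite tpermJ tpermL tpermD //; apply/eqP => /(congr1 val) /=; lia.
  by rewrite conjgE tpermV; apply: (PM _ _ Pz (PM _ _ (IHd z _) Pz)).
suff : P s by apply.
have [ts -> _] := prod_tpermP s; elim: ts => [|[x y] ts IHts].
  by rewrite big_nil => al'; apply: eq_ntab => i; rewrite /= perm1.
rewrite big_cons; apply: PM => //=.
have [lt|lt|/val_inj->] := ltngtP x y.
- by apply: (Ptr (y - x.+1)%N); lia.
- by rewrite tpermC; apply: (Ptr (x - y.+1)%N); lia.
- by rewrite tperm1 => al'; apply: eq_ntab => i; rewrite /= perm1.
Qed.

Lemma ntab_widen m M (al : 'I_m -> nat) (be : 'I_M -> nat) (le_mM : (m <= M)%N) :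
    (forall i, be (widen_ord le_mM i) = al i) ->
    (forall j : 'I_M, (m <= j)%N -> be j = 0%N) ->
  ntab la al = ntab la be.
Proof.
move=> be_al be0.
have w_inj : injective (widen_ord le_mM) by move=> i j /(congr1 val) /= /val_inj.
pose w (T : {ffun cell la -> 'I_m}) := [ffun c => widen_ord le_mM (T c)].
have winj : injective w.
  by move=> T T' /ffunP e; apply/ffunP => c; have := e c; rewrite !ffunE => /w_inj.
have wss T : ssyt (w T) = ssyt T.
  by rewrite /ssyt; congr (_ && _); apply: eq_forallb => c;
     apply: eq_forallb => d; rewrite !ffunE.
rewrite /ntab -(card_imset _ winj); apply: eq_card => T'.
rewrite [RHS]inE; apply/imsetP/andP => [[T /[!inE] /andP[ss /forallP ct] ->]|[ss /forallP ct]].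
  rewrite wss; split=> //; apply/forallP => j; have [lt|le] := ltnP j m.
    have -> : j = widen_ord le_mM (Ordinal lt) by apply: val_inj.
    rewrite be_al -(eqP (ct _)); apply/eqP/eq_card => c.
    by rewrite !inE ffunE (inj_eq w_inj).
  rewrite be0 // cards_eq0; apply/eqP/setP => c; rewrite !inE ffunE.
  by apply/negbTE; apply: contraTneq le => <-; rewrite -ltnNge /=.
have lt c : (T' c < m)%N.
  rewrite ltnNge; apply/negP => le; have := ct (T' c); rewrite be0 // cards_eq0.
  by move/eqP/setP/(_ c); rewrite !inE eqxx.
have eT : T' = w [ffun c => Ordinal (lt c)].
  by apply/ffunP => c; rewrite !ffunE; apply: val_inj.
exists [ffun c => Ordinal (lt c)] => //; rewrite inE -wss -eT ss /=.
apply/forallP => i; rewrite -be_al -(eqP (ct _)); apply/eqP/eq_card => c.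
by rewrite !inE ffunE -!val_eqE.
Qed.

End KostkaSymmetry.

(** * Sorting contents into partitions *)

Definition extn m (al : 'I_m -> nat) (j : nat) : nat := oapp al 0%N (insub j).

Lemma extnE m (al : 'I_m -> nat) (i : 'I_m) : extn al i = al i.
Proof. by rewrite /extn valK. Qed.

Lemma extn_out m (al : 'I_m -> nat) j : (m <= j)%N -> extn al j = 0%N.
Proof. by move=> le; rewrite /extn insubF // ltnNge le. Qed.

Lemma extn_lt m (al : 'I_m -> nat) j (lt : (j < m)%N) : extn al j = al (Ordinal lt).
Proof. by rewrite -extnE. Qed.

Lemma sort_content n m (al : 'I_m -> nat) : (\sum_i al i)%N = n ->
  exists (mu : intpart n) (p : 'S_(m + n)),
    forall j : 'I_(m + n), extn (fun i => mu i : nat) j = extn al (p j).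
Proof.
move=> sum_al.
pose t := [tuple extn al j | j < m + n].
pose u := sort geq t.
have pu : perm_eq u t by rewrite perm_sort.
have size_u : size u = (m + n)%N by rewrite size_sort size_tuple.
have sum_t : (\sum_(j < m + n) nth 0 u j)%N = n.
  rewrite -[RHS]sum_al -(big_mkord xpredT (nth 0 u)) -size_u -(big_nth 0 xpredT id).
  rewrite (perm_big _ pu) /= big_map big_enum /= big_split_ord /=.
  rewrite [X in (_ + X)%N]big1 ?addn0 => [|j _].
    by apply: eq_bigr => i _; rewrite extnE.
  by rewrite extn_out //= leq_addr.
have mono i j : (i <= j)%N -> (j < m + n)%N -> (nth 0 u j <= nth 0 u i)%N.
  move=> le lt; apply: (sorted_leq_nth (leT := geq)) => //.
  - by move=> x y z /= h1 h2; apply: leq_trans h2 h1.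
  - by move=> x /=.
  - by apply: sort_sorted => x y /=; apply: leq_total.
  - by rewrite inE size_u (leq_ltn_trans le).
  - by rewrite inE size_u.
(* A positive entry at [j] would make the first [j.+1] entries of the sorted list positive, and
   their sum would exceed [n]. *)
have u0 j : (n <= j)%N -> nth 0 u j = 0%N.
  move=> le; have [lt|ge] := ltnP j (m + n); last by rewrite nth_default // size_u.
  apply/eqP; rewrite -leqn0 leqNgt; apply/negP => gt0.
  suff : (j.+1 <= n)%N by rewrite ltnNge le.
  rewrite -[X in (_ <= X)%N]sum_t -[X in (X <= _)%N](card_ord_lt lt) -sum1_card big_mkcond /=.
  apply: leq_sum => i _; rewrite inE ltnS; case: ifP => // le_ij.
  by apply: leq_trans gt0 _; rewrite mono.
have sum_n : (\sum_(j < n) nth 0 u j)%N = n.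
  rewrite -[RHS]sum_t addnC big_split_ord /= [X in _ = (_ + X)%N]big1 ?addn0 // => j _.
  by rewrite u0 // leq_addr.
have le_n i : (nth 0 u i <= n)%N.
  have [lt|le] := ltnP i n; last by rewrite u0.
  by rewrite -[X in (_ <= X)%N]sum_n (bigD1 (Ordinal lt)) //= leq_addr.
pose f : {ffun 'I_n -> 'I_n.+1} := [ffun i : 'I_n => inord (nth 0 u i)].
have fE (i : 'I_n) : f i = nth 0 u i :> nat by rewrite ffunE inordK // ltnS.
have fP : is_intpart f.
  apply/andP; split.
    apply/'forall_forallP => i j; apply/implyP => le; rewrite !fE mono //.
    by rewrite (leq_trans (ltn_ord j)) // leq_addl.
  by apply/eqP; rewrite -[RHS]sum_n; apply: eq_bigr => i _; rewrite fE.
have /tuple_permP[p pE] := pu.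
exists (IntPart fP), p => j.
transitivity (nth 0 u j).
  have [lt|le] := ltnP j n; last by rewrite extn_out // u0.
  by rewrite (extn_lt _ lt) fE.
by rewrite pE -tnth_nth !tnth_mktuple.
Qed.

Lemma block_of_fiber n (mu : intpart n) (v : nat) :
  #|[set i : 'I_n | block_of mu i == v]| = extn (fun i => mu i : nat) v.
Proof.
pose Q v := (\sum_(s < n | s < v) mu s)%N.
have Qmono v1 v2 : (v1 <= v2)%N -> (Q v1 <= Q v2)%N.
  move=> le; rewrite /Q big_mkcond [X in (_ <= X)%N]big_mkcond; apply: leq_sum => s _.
  by case: ltnP => // lt; rewrite (leq_trans lt le).
have Qn w : (n <= w)%N -> Q w = n.
  move=> le; rewrite -[RHS](intpart_sum mu) /Q; apply: eq_bigl => s.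
  by rewrite (leq_trans (ltn_ord s) le).
(* [block_of] counts the partial sums of [mu] that are at most [i]; their indices are down-closed,
   so the count can be compared with one index. *)
have block_lt i w : (w <= n)%N -> (block_of mu i < w)%N = (i < Q w)%N.
  case: w => [|w] lt; first by rewrite /Q big_pred0 ?ltn0.
  rewrite ltnS leqNgt [RHS]ltnNge; congr negb.
  rewrite -[w]/(nat_of_ord (Ordinal lt)) /block_of -mem_down_closed; first by rewrite inE.
  move=> r r' lt_rr'; rewrite !inE => le.
  by apply: leq_trans (Qmono r.+1 r'.+1 _) le; rewrite ltnS ltnW.
have card_lt w : (w <= n)%N -> #|[set i : 'I_n | (block_of mu i < w)%N]| = Q w.
  move=> le; rewrite -[RHS](card_ord_lt (n := n)); last by rewrite -(Qn _ (leqnn n)) Qmono.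
  by apply: eq_card => i; rewrite !inE block_lt.
have [lt|le] := ltnP v n; last first.
  rewrite extn_out //; apply/eqP; rewrite cards_eq0; apply/eqP/setP => i; rewrite !inE.
  by apply: ltn_eqF; rewrite (leq_trans _ le) // block_lt // Qn.
have split_lt : (#|[set i : 'I_n | block_of mu i < v]| + #|[set i : 'I_n | block_of mu i == v]|
    = #|[set i : 'I_n | block_of mu i < v.+1]|)%N.
  rewrite -cardsUI.
  have -> : [set i : 'I_n | (block_of mu i < v)%N] :&: [set i | block_of mu i == v] = set0.
    by apply/setP => i; rewrite !inE; case: eqP => [->|]; rewrite ?ltnn ?andbF.
  rewrite cards0 addn0; apply: eq_card => i.
  by rewrite !inE ltnS [in RHS]leq_eqVlt orbC.
have QS : (Q v.+1 = Q v + mu (Ordinal lt))%N.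
  rewrite /Q (bigD1 (Ordinal lt)) //= addnC; congr (_ + _)%N; apply: eq_bigl => s.
  by rewrite -val_eqE /= ltnS ltn_neqAle andbC.
move: split_lt; rewrite !card_lt ?(ltnW lt) // QS => /addnI ->.
by rewrite (extn_lt _ lt).
Qed.

(** The same sorted content [mu] serves both sides: Kostka numbers are symmetric in the content, and
    the fibers of [k] match the blocks of [mu] up to a permutation, as [Ind_parabolic_eq]
    requires. *)
Lemma content_partition n m (k : {ffun 'I_n -> 'I_m}) :
  exists mu : intpart n,
    (forall la, ntab la (fun v => #|[set i | k i == v]|) = Kostka la mu)
    /\ exists s : 'S_n, forall i j,
         (block_of mu (s i) == block_of mu (s j)) = (k i == k j).
Proof.
pose al v := #|[set i | k i == v]|.
have sum_al : (\sum_v al v)%N = n.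
  rewrite -[RHS]card_ord -sum1_card (partition_big k xpredT) //=.
  by apply: eq_bigr => v _; rewrite /al -sum1_card; apply: eq_bigl => i; rewrite inE.
have [mu [p pE]] := sort_content sum_al; exists mu; split.
  move=> la; transitivity (ntab la (fun j : 'I_(m + n) => extn al j)).
    apply: (@ntab_widen _ _ _ _ _ _ (leq_addr n m)) => [i|j]; last exact: extn_out.
    by rewrite -[nat_of_ord _]/(nat_of_ord i) extnE.
  rewrite -(ntab_perm _ _ p) -[Kostka la mu]/(ntab la (fun i => mu i : nat)).
  apply/esym; apply: (@ntab_widen _ _ _ _ _ _ (leq_addl m n)) => [i|j le] /=.
    by rewrite -pE -[nat_of_ord _]/(nat_of_ord i) extnE.
  by rewrite -pE extn_out.
have lt_b (i : 'I_n) : (block_of mu i < m + n)%N.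
  rewrite ltnNge; apply/negP => le.
  have := block_of_fiber mu (block_of mu i); rewrite extn_out; last first.
    by apply: leq_trans le; apply: leq_addl.
  by move/eqP; rewrite cards_eq0 => /eqP/setP/(_ i); rewrite !inE eqxx.
(* Relabelling the blocks by [p] gives the two words the same content in ['I_(m + n)]. *)
pose f1 i := p (Ordinal (lt_b i)); pose f2 i := widen_ord (leq_addr n m) (k i).
have [v|s sE] := @same_fibers_perm n _ f1 f2.
  transitivity (extn al v).
    rewrite -{2}[v](permKV p) -pE -block_of_fiber; apply: eq_card => i.
    by rewrite !inE /f1 -(inj_eq (@perm_inj _ p^-1%g)) permK -val_eqE.
  have [lt|le] := ltnP v m.
    rewrite (extn_lt _ lt); apply: eq_card => i; rewrite !inE.
    by rewrite -!val_eqE.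
  rewrite extn_out //; apply/esym/eqP; rewrite cards_eq0; apply/eqP/setP => i.
  rewrite !inE; apply/negbTE; apply: contraTneq le => <-; by rewrite -ltnNge /=.
exists s => i j; have := sE i; have := sE j; rewrite /f1 /f2 => ej ei.
have -> : (k i == k j) = (f2 i == f2 j) by rewrite -!val_eqE.
by rewrite /f2 ei ej (inj_eq perm_inj) -val_eqE.
Qed.

(** * Schur functions and omega *)

Lemma mcoeff_prodX (I : finType) m (f : I -> 'I_m) (al : 'X_{1..m}) :
  (\prod_i 'X_(f i) : {mpoly algC[m]})@_al
  = [forall v, #|[set i | f i == v]| == al v]%:R.
Proof.
rewrite mprodXE mcoeffX; congr (nat_of_bool _)%:R.
have cE v : (\sum_i U_(f i))%MM v = #|[set i | f i == v]|.
  rewrite mnm_sumE -sum1_card [RHS]big_mkcond; apply: eq_bigr => i _.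
  by rewrite mnm1E inE; case: eqP.
apply/eqP/eqfunP => [<- v|e]; first by rewrite cE.
by apply/mnmP => v; rewrite cE.
Qed.

Lemma mcoeff_schur n (la : intpart n) m (al : 'X_{1..m}) :
  (schur la m)@_al = (ntab la al)%:R.
Proof.
rewrite /schur raddf_sum /= /ntab -sum1_card natr_sum big_mkcond [RHS]big_mkcond.
apply: eq_bigr => T _; rewrite inE mcoeff_prodX.
by case: (ssyt T) => //=; case: ifP.
Qed.

Lemma mcoeff_LLT n (p : seq step) (t : algC) m (al : 'X_{1..m}) :
  (LLT n p t m)@_al = \sum_(k : {ffun 'I_n -> 'I_m} |
      [forall v, #|[set i | k i == v]| == al v]
      && [forall e in Diag n p, (k e.1 < k e.2)%N]) t ^+ asc p k.
Proof.
rewrite /LLT raddf_sum /= big_mkcond [RHS]big_mkcond; apply: eq_bigr => k _.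
rewrite mcoeffZ mcoeff_prodX [in RHS]andbC; case: ifP => //= _.
by case: ifP; rewrite ?mulr1 ?mulr0.
Qed.

(** Macdonald's statistic n(la). It replaces the dominance order in the triangularity argument. *)
Definition row_weight n (la : intpart n) : nat := (\sum_(i < n) i * la i)%N.

Lemma sum_entries (I : finType) m (f : I -> 'I_m) :
  (\sum_i f i = \sum_(v < m) v * #|[set i | f i == v]|)%N.
Proof.
rewrite (partition_big f xpredT) //=; apply: eq_bigr => v _.
rewrite (eq_bigr (fun=> nat_of_ord v)) => [|i /eqP-> //].
rewrite sum_nat_const mulnC; congr (_ * _)%N; apply: eq_card => i.
by rewrite inE.
Qed.

Lemma card_row_cells n (la : intpart n) (r : 'I_n) :
  #|[set c : cell la | (val c).1 == r]| = la r.
Proof.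
rewrite -[RHS](card_row (leqnn _)); apply: eq_card => c; rewrite !inE.
by case: eqP => //= <-; rewrite cell_col_lt.
Qed.

Lemma sum_rows n (la : intpart n) : (\sum_(c : cell la) (val c).1 = row_weight la)%N.
Proof. by rewrite sum_entries; apply: eq_bigr => r _; rewrite card_row_cells. Qed.

Lemma row_le_entry n (la : intpart n) m (T : {ffun cell la -> 'I_m}) (c : cell la) :
  ssyt T -> ((val c).1 <= T c)%N.
Proof.
move=> Tss; rewrite leqNgt; apply/negP; rewrite (lt_row_count Tss).
suff z x r : (x <= r)%N -> row_count T x r = 0%N by rewrite z.
elim: x r => [|x IHx] [|r] // le.
- by apply/eqP; rewrite cards_eq0; apply/eqP/setP => d; rewrite !inE andbF.
- by apply/eqP; rewrite cards_eq0; apply/eqP/setP => d; rewrite !inE andbF.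
by apply/eqP; rewrite -leqn0 (leq_trans (row_count_interlace Tss _ _)) // IHx.
Qed.

(** The entries of a tableau add up to the weight of its content, the row numbers to the weight of
    its shape, and no entry is below its row number. Equality forces each entry to be its row
    number, so content and shape agree. *)
Lemma ntab_weight n (la mu : intpart n) :
    ntab la (fun i => mu i : nat) != 0%N ->
  (row_weight la <= row_weight mu ?= iff (la == mu))%N.
Proof.
rewrite -lt0n card_gt0 => /set0Pn[T]; rewrite inE => /andP[Tss /forallP ct].
have wT : row_weight mu = (\sum_c T c)%N.
  by rewrite sum_entries; apply: eq_bigr => v _; rewrite (eqP (ct v)).
rewrite wT -sum_rows; split; first by apply: leq_sum => c _; apply: row_le_entry.
apply/eqP/eqP => [e|elm].
  have rT := sum_leq_eq (fun c => row_le_entry c Tss) e.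
  apply: val_inj; apply/ffunP => i; apply: val_inj => /=.
  rewrite -[LHS]card_row_cells -(eqP (ct i)); apply: eq_card => c.
  by rewrite !inE (val_inj (rT c)).
by rewrite sum_rows -wT elm.
Qed.

Lemma ntab_diag n (la : intpart n) : ntab la (fun i => la i : nat) != 0%N.
Proof.
rewrite -lt0n card_gt0; apply/set0Pn; exists [ffun c : cell la => (val c).1].
rewrite inE; apply/andP; split.
  by apply/ssytP; split=> c d e lt; rewrite !ffunE // e.
apply/forallP => i; rewrite -[X in _ == X]card_row_cells.
by apply/eqP/eq_card => c; rewrite !inE ffunE.
Qed.

Lemma ntab_sum n (la : intpart n) m (al : 'I_m -> nat) :
  ntab la al != 0%N -> (\sum_i al i)%N = n.
Proof.
rewrite -lt0n card_gt0 => /set0Pn[T]; rewrite inE => /andP[_ /forallP ct].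
rewrite -[RHS](card_cells la) -sum1_card (partition_big T xpredT) //=.
apply: eq_bigr => v _; rewrite -(eqP (ct v)) -sum1_card; apply: eq_bigl => c.
by rewrite inE.
Qed.

(** Among the partitions of [k] with nonzero coefficient take [mu] of least weight and extract the
    monomial of exponent [mu] in [k] variables: [ntab_sum] kills the other degrees and [ntab_weight]
    the other shapes. *)
Lemma schur_free N (d : forall k, intpart k -> algC) :
    (forall m, \sum_(k < N) \sum_(la : intpart k) d k la *: schur la m = 0) ->
  forall k (la : intpart k), (k < N)%N -> d k la = 0.
Proof.
move=> d0 k la lt_k; apply/eqP; apply/negPn/negP => nz.
have [mu dmu mu_min] := @arg_minnP _ la (fun la => d k la != 0) (@row_weight k) nz.
pose al : 'X_{1..k} := [multinom nat_of_ord (mu i) | i < k].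
have alE (i : 'I_k) : al i = mu i by rewrite mnmE.
have nE (j : nat) (nu : intpart j) : ntab nu al = ntab nu (fun i => mu i : nat).
  exact: eq_ntab.
have := congr1 (fun f : {mpoly algC[k]} => f@_al) (d0 k).
rewrite mcoeff0 raddf_sum /= (bigD1 (Ordinal lt_k)) //= [X in _ + X]big1.
  rewrite addr0 raddf_sum /= (bigD1 mu) //= big1 => [|nu neq].
    rewrite addr0 mcoeffZ mcoeff_schur nE => /eqP; rewrite mulf_eq0 (negbTE dmu) /=.
    by rewrite pnatr_eq0 (negbTE (ntab_diag mu)).
  rewrite mcoeffZ mcoeff_schur nE; apply/eqP; rewrite mulf_eq0 pnatr_eq0.
  apply: contraR neq; rewrite negb_or => /andP[dnu tab].
  have [le eq] := ntab_weight tab.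
  by rewrite -eq eqn_leq le mu_min.
move=> [j lt_j] /= neq; rewrite raddf_sum big1 // => nu _ /=.
rewrite mcoeffZ mcoeff_schur nE; have [->|tab] := eqVneq (ntab nu (fun i => mu i : nat)) 0%N.
  by rewrite mulr0.
case/eqP: neq; apply: val_inj => /=.
by rewrite -(ntab_sum tab) intpart_sum.
Qed.

Section Omega.
Variables (n : nat) (c : intpart n -> algC).

(** Extends [c] by zero to all degrees, since [omega_graph] allows inhomogeneous expansions. *)
Let cc k (la : intpart k) : algC :=
  if k =P n is ReflectT e then c (ecast k (intpart k) e la) else 0.

Let cc_n la : @cc n la = c la.
Proof. by rewrite /cc; case: eqP => // e; rewrite (eq_irrelevance e (erefl n)). Qed.

Let cc_neq k la : k != n -> @cc k la = 0.
Proof. by rewrite /cc; case: eqP. Qed.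

Let sum_cc (V : lmodType algC) (G : forall k, intpart k -> V) M : (n < M)%N ->
  \sum_(k < M) \sum_(la : intpart k) cc la *: G k la = \sum_la c la *: G n la.
Proof.
move=> lt; rewrite (bigD1 (Ordinal lt)) //= [X in _ + X]big1 => [|k neq].
  by rewrite addr0; apply: eq_bigr => la _; rewrite cc_n.
by rewrite big1 // => la _; rewrite cc_neq ?scale0r //; rewrite -val_eqE in neq.
Qed.

Lemma omegaE (f : symfun) :
    (forall m, f m = \sum_la c la *: schur la m) ->
  forall m, omega f m = \sum_la c la *: schur (conjpart la) m.
Proof.
move=> fE m.
have : omega_graph f (omega f).
  apply: (ClassicalEpsilon.epsilon_spec (inhabits f)).
  exists (fun m => \sum_la c la *: schur (conjpart la) m), n.+1, cc; split=> m'.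
    by rewrite fE (sum_cc (fun k la => schur la m')).
  by rewrite (sum_cc (fun k la => schur (conjpart la) m')).
case=> N [c' [fc' ->]].
(* The expansion behind [omega f] is only known to exist. Padding it and [cc] to a common degree
   bound lets [schur_free] identify them. *)
pose M := maxn N n.+1; pose c1 k (la : intpart k) := if (k < N)%N then c' k la else 0.
have sum_c1 (V : lmodType algC) (G : forall k, intpart k -> V) :
    \sum_(k < N) \sum_(la : intpart k) c' k la *: G k la
    = \sum_(k < M) \sum_(la : intpart k) c1 k la *: G k la.
  rewrite (big_ord_widen M (fun k => \sum_(la : intpart k) c' k la *: G k la)) ?leq_maxl //.
  rewrite big_mkcond; apply: eq_bigr => k _; rewrite /c1; case: ifP => // _.
  by rewrite big1 // => la _; rewrite scale0r.
have lt_nM : (n < M)%N by rewrite leq_maxr.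
have free := @schur_free M (fun k la => c1 k la - cc la).
rewrite (sum_c1 _ (fun k la => schur (conjpart la) m)).
rewrite -(sum_cc (fun k la => schur (conjpart la) m) lt_nM).
apply: eq_bigr => k _; apply: eq_bigr => la _; congr (_ *: _).
apply/eqP; rewrite -subr_eq0; apply/eqP/free => // m'.
under eq_bigr => j _ do under eq_bigr => nu _ do rewrite scalerBl.
under eq_bigr => j _ do rewrite sumrB.
rewrite sumrB -(sum_c1 _ (fun k la => schur la m')) -fc' fE.
by rewrite (sum_cc (fun k la => schur la m')) // subrr.
Qed.

End Omega.

(** * Unipotent characters *)

Section UnipotentMultiplicities.
Variables (F : finFieldType) (n : nat) (chi : intpart n -> Iirr [set: GL F n]).
Hypothesis hchi : unipotent_indexing chi.

Lemma block_of_mono (mu : intpart n) (i j : 'I_n) :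
  (i <= j)%N -> (block_of mu i <= block_of mu j)%N.
Proof.
move=> le; apply: subset_leq_card; apply/subsetP => r; rewrite !inE => le_i.
exact: leq_trans le_i le.
Qed.

(** By Frobenius reciprocity the restriction to the parabolic contains the trivial character, and so
    does the further restriction to the Borel subgroup. *)
Lemma Ind_parabolic_constt (mu : intpart n) i :
    '['Ind[[set: GL F n]] (1 : 'CF(parabolic F (block_of mu))), 'chi_i] != 0 ->
  i \in irr_constt ('Ind[[set: GL F n]] (1 : 'CF(Borel F n))).
Proof.
have sBP : Borel F n \subset parabolic F (block_of mu).
  apply/subsetP => g /parabolicP gB; apply/parabolicP => r s lt.
  by apply: gB; apply: contraTT lt; rewrite -!leqNgt; apply: block_of_mono.
rewrite -irr_consttE -!irr0 !constt_Ind_Res => h.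
rewrite -(cfResRes _ sBP (subsetT _)).
apply: (constt_Res_trans (cfRes_char _ (irr_char i)) h).
by rewrite irr0 cfRes_cfun1 ?sBP // -irr0 irr_consttE cfdot_irr eqxx oner_eq0.
Qed.

(** Irreducible characters outside the image of [chi] are not constituents of the flag character, so
    only unipotent multiplicities of [phi] enter. *)
Lemma cfdot_Ind_parabolic (phi : 'CF([set: GL F n])) (mu : intpart n) :
  '[phi, 'Ind[[set: GL F n]] (1 : 'CF(parabolic F (block_of mu)))]
  = \sum_la '[phi, 'chi_(chi la)] * (Kostka (conjpart la) mu)%:R.
Proof.
have [chi_inj chi_unip chi_mult] := hchi.
rewrite cfdot_sum_irr (bigID (mem [set chi la | la : intpart n])) /=.
rewrite [X in _ + X]big1 => [|i notin]; last first.
  apply/eqP; rewrite mulf_eq0 conjC_eq0 orbC; apply: contraR notin.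
  rewrite negb_or => /andP[nz _]; have /chi_unip[la ->] := Ind_parabolic_constt nz.
  exact: imset_f.
rewrite addr0 big_imset /=; last by move=> ? ? _ _; apply: chi_inj.
by apply: eq_bigr => la _; rewrite chi_mult conjC_nat.
Qed.

End UnipotentMultiplicities.

(** * Comparison of Schur coefficients *)

Lemma sum_conjpart n (V : nmodType) (G : intpart n -> V) :
  \sum_la G (conjpart la) = \sum_la G la.
Proof.
by rewrite [RHS](reindex_inj (inv_inj (@conjpartK n))).
Qed.

Lemma ntab_word n (la : intpart n) m (al : 'I_m -> nat) : ntab la al != 0%N ->
  exists k : {ffun 'I_n -> 'I_m}, forall v, #|[set i | k i == v]| = al v.
Proof.
rewrite -lt0n card_gt0 => /set0Pn[T]; rewrite inE => /andP[_ /forallP ct].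
pose e (i : 'I_n) : cell la := enum_val (cast_ord (esym (card_cells la)) i).
have e_inj : injective e by move=> i j /enum_val_inj/cast_ord_inj.
have e_surj c : exists i, c = e i.
  exists (cast_ord (card_cells la) (enum_rank c)).
  by rewrite /e cast_ordK enum_rankK.
exists [ffun i => T (e i)] => v; rewrite -(eqP (ct v)) -(card_imset _ e_inj).
apply: eq_card => c; have [i ->] := e_surj c.
by rewrite (mem_imset _ _ e_inj) !inE ffunE.
Qed.

Theorem theorem5p1 (F : finFieldType) (n : nat)
    (chi : intpart n -> Iirr [set: GL F n]) (hchi : unipotent_indexing chi)
    (sigma : seq step) (hsigma : schroder n sigma) (htall : tall sigma) :
  forall m : nat,
    p_one chi ('Ind[[set: GL F n]] (psi F n sigma)) m
    = (#|F|%:R - 1) ^+ #|Diag n sigma| *: omega (LLT n sigma #|F|%:R) m.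
Proof.
set q : algC := #|F|%:R; set Psi := 'Ind[_] _.
pose d := (q - 1) ^+ #|Diag n sigma|.
have d_neq0 : d != 0.
  rewrite expf_neq0 // subr_eq0 -[1]/(1%:R) eqr_nat neq_ltn orbC.
  by rewrite finNzRing_gt1.
pose a la := '[Psi, 'chi_(chi la)].
(* [omega] can only be evaluated on an explicit Schur expansion. This one is checked monomial by
   monomial, and the division by [d] is legitimate because [q > 1]. *)
have LLTE m' : LLT n sigma q m' = \sum_la (d^-1 * a (conjpart la)) *: schur la m'.
  apply/mpolyP => al; rewrite [RHS]raddf_sum /=.
  rewrite (eq_bigr (fun la => d^-1 * (a (conjpart la) * (ntab la al)%:R))); last first.
    by move=> la _; rewrite mcoeffZ mcoeff_schur mulrA.
  rewrite -mulr_sumr -sum_conjpart; under eq_bigr => la _ do rewrite conjpartK.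
  apply: (mulfI d_neq0); rewrite mulVKf // mcoeff_LLT.
  (* If no word has content [al], there is no coloring and, by [ntab_word], no tableau of that
     content, so both coefficients vanish. *)
  have [k0 k0P|nok] := pickP (fun k : {ffun 'I_n -> 'I_m'} =>
      [forall v, #|[set i | k i == v]| == al v]); last first.
    rewrite big1 => [|k /andP[]]; last by rewrite nok.
    rewrite mulr0 big1 // => la _.
    have [->|/ntab_word[k kP]] := eqVneq (ntab (conjpart la) al) 0%N; first exact: mulr0.
    by have := nok k; case: eqfunP.
  have alE v : #|[set i | k0 i == v]| = al v by apply/eqP; apply: (forallP k0P).
  have [mu [tabE [s sE]]] := content_partition k0.
  (* Both coefficients, scaled by [d], are this pairing: the double coset computation gives the sum
     over colorings, the unipotent decomposition the sum of Kostka numbers. *)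
  transitivity '[Psi, 'Ind[[set: GL F n]] (1 : 'CF(parabolic F (block_of mu)))].
    rewrite (@Ind_parabolic_eq F n _ (fun i => (m' - k0 i)%N) s) => [|i j].
      rewrite cfdot_Ind_psi; congr (_ * _); apply: eq_bigl => k; congr (_ && _).
      by apply: eq_forallb => v; rewrite alE.
    rewrite sE; apply/eqP/eqP => [->//|e]; apply: val_inj => /=.
    by move: e (ltn_ord (k0 i)) (ltn_ord (k0 j)) => /=; lia.
  rewrite (cfdot_Ind_parabolic hchi); apply: eq_bigr => la _.
  by rewrite -tabE; congr (_ * _%:R); apply: eq_ntab.
move=> m; rewrite (omegaE LLTE) scaler_sumr -[LHS]sum_conjpart.
by apply: eq_bigr => la _; rewrite scalerA mulVKf.
Qed.
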